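(* Let $\theta\in M_n(\mathbb R)$ be an anti-symmetric matrix, let $F_\theta$ denote the phase of the $\theta$-deformed Dirac operator $D_\theta$ on $L^2(\mathbb T^n_\theta,S)$, and let $\alpha\in(0,1)$. For any $a\in C^\alpha(\mathbb T^n_\theta)$ the operator $[F_\theta,a]$ extends to a bounded operator $$[F_\theta,a]:W^s(\mathbb T^n_\theta,S)\to W^{s+\alpha}(\mathbb T^n_\theta,S)\qquad\text{for any }s\in(-\alpha,0).$$
   Context: $C(\mathbb T^n_\theta)$ is the universal $C^*$-algebra generated by unitaries $U_1,\dots,U_n$ with $U_jU_k=e^{i\theta_{jk}}U_kU_j$. For $\mathbf k=(k_1,\dots,k_n)\in\mathbb Z^n$ put $U^{\mathbf k}=U_1^{k_1}\cdots U_n^{k_n}$. The torus $\mathbb T^n$ acts on $C(\mathbb T^n_\theta)$ by $z.U_j=z_jU_j$. The tracial state $\tau_0$ is determined by $\tau_0(U^{\mathbf k})=\delta_{0,\mathbf k}$; $L^2(\mathbb T^n_\theta)$ is its GNS space, with orthonormal basis $\{U^{\mathbf k}\}_{\mathbf k\in\mathbb Z^n}$, on which $C(\mathbb T^n_\theta)$ acts by left multiplication. Let $S_n=\mathbb C^{2^{\lfloor n/2\rfloor}}$ be the spinor space with Clifford multiplication $c:\mathbb R^n\to\mathrm{End}(S_n)$, normalized so that $c(\xi)$ is self-adjoint and $c(\xi)^2=|\xi|^2$. Put $L^2(\mathbb T^n_\theta,S)=L^2(\mathbb T^n_\theta)\otimes S_n$. The deformed Dirac operator and its phase are given by $D_\theta(U^{\mathbf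 k}\otimes v)=U^{\mathbf k}\otimes c(\mathbf k)v$ and $F_\theta=D_\theta|D_\theta|^{-1}$, i.e. $F_\theta(U^{\mathbf k}\otimes v)=U^{\mathbf k}\otimes\frac{c(\mathbf k)}{|\mathbf k|}v$ for $\mathbf k\ne0$ and $F_\theta(U^0\otimes v)=0$. Elements $a\in C(\mathbb T^n_\theta)$ act as $a\otimes\mathrm{id}_{S_n}$. For $s\in\mathbb R$, $W^s(\mathbb T^n_\theta,S)$ is the Sobolev space of the Laplacian $\Delta_\theta U^{\mathbf k}=|\mathbf k|^2U^{\mathbf k}$: the completion of the linear span of the $U^{\mathbf k}\otimes v$ in the norm $\|\sum_{\mathbf k}U^{\mathbf k}\otimes v_{\mathbf k}\|_{W^s}^2=\sum_{\mathbf k}(1+|\mathbf k|^2)^s\|v_{\mathbf k}\|^2$ (for $s\ge0$ this is $\mathrm{Dom}(|D_\theta|^s)$). The Hölder space is $C^\alpha(\mathbb T^n_\theta):=C^\alpha(\mathbb T^n,C(\mathbb T^n_\theta))^{\mathbb T^n}$ (invariants for the diagonal action), identified with the set of $a\in C(\mathbb T^n_\theta)$ such that $z\mapsto z.a$ is a Hölder continuous map of exponent $\alpha$ from $\mathbb T^n$ to $C(\mathbb T^n_\theta)$. *)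

(* Defs.v *)
From HB Require Import structures.
From mathcomp Require Import all_boot all_order all_algebra.
From mathcomp Require Import complex.
From mathcomp Require Import all_classical all_reals all_analysis.

Set Implicit Arguments.
Unset Strict Implicit.
Unset Printing Implicit Defensive.

Import Order.TTheory GRing.Theory Num.Theory numFieldNormedType.Exports.

Local Open Scope classical_set_scope.
Local Open Scope complex_scope.
Local Open Scope ring_scope.

(** * Unital C*-algebras *)

(* The norm is a field of the mixin because a common substructure of
   [completeNormedModType] and [algType] cannot be declared: it would be a
   second join, besides [numDomainType], of rings and normed groups. *)
HB.mixin Record Algebra_isCStar (R : realType) A of GRing.Algebra R[i] A := {
  star : A -> A;
  starK : involutive star;
  starD : {morph star : a b / a + b};
  starZ : forall (z : R[i]) (a : A), star (z *: a) = Num.conj z *: star a;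
  starM : forall a b : A, star (a * b) = star b * star a;
  cnorm : A -> R;
  cnorm_ge0 : forall a : A, 0 <= cnorm a;
  cnorm0_eq0 : forall a : A, cnorm a = 0 -> a = 0;
  cnormD_le : forall a b : A, cnorm (a + b) <= cnorm a + cnorm b;
  cnormZ : forall (z : R[i]) (a : A), cnorm (z *: a) = complex.Re `|z| * cnorm a;
  cnormM_le : forall a b : A, cnorm (a * b) <= cnorm a * cnorm b;
  cstar_identity : forall a : A, cnorm (star a * a) = cnorm a ^+ 2;
  cnorm_complete : forall u : nat -> A,
    (forall e : R, 0 < e -> exists N : nat, forall p q : nat,
       (N <= p)%N -> (N <= q)%N -> cnorm (u p - u q) < e) ->
    exists l : A, forall e : R, 0 < e -> exists N : nat, forall p : nat,
      (N <= p)%N -> cnorm (u p - l) < e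
}.

#[short(type="cstarAlgType")]
HB.structure Definition CStarAlgebra (R : realType) :=
  {A of GRing.Algebra R[i] A & Algebra_isCStar R A}.

Definition norm_closed (R : realType) (A : cstarAlgType R) (S : set A) : Prop :=
  forall a : A, (forall e : R, 0 < e -> exists2 b, S b & cnorm (a - b) < e) ->
    S a.

Definition star_hom (R : realType) (A B : cstarAlgType R) (f : A -> B) : Prop :=
  [/\ linear f, f 1 = 1, (forall a b, f (a * b) = f a * f b)
    & forall a, f (star a) = star (f a)].

Definition unitary (R : realType) (A : cstarAlgType R) (u : A) : Prop :=
  star u * u = 1 /\ u * star u = 1.

(* No proper C*-subalgebra contains all the [U j]. *)
Definition cstar_generates (R : realType) (A : cstarAlgType R) (n : nat)
    (U : 'I_n -> A) : Prop :=
  forall S : set A,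
    norm_closed S -> S 1 ->
    (forall (z : R[i]) a b, S a -> S b -> S (z *: a + b)) ->
    (forall a b, S a -> S b -> S (a * b)) ->
    (forall a, S a -> S (star a)) ->
    (forall j, S (U j)) -> S = setT.

Definition tracial_state (R : realType) (A : cstarAlgType R) (tau : A -> R[i])
    : Prop :=
  [/\ (forall (z : R[i]) a b, tau (z *: a + b) = z * tau a + tau b),
      tau 1 = 1,
      (forall a, 0 <= tau (star a * a))
    & forall a b, tau (a * b) = tau (b * a)].

(** * The noncommutative torus *)

Definition expi (R : realType) (t : R) : R[i] := (cos t +i* sin t)%C.

Definition nct_relations (R : realType) (n : nat) (theta : 'M[R]_n)
    (A : cstarAlgType R) (U : 'I_n -> A) : Prop :=
  (forall j, unitary (U j)) /\
  (forall j k, U j * U k = expi (theta j k) *: (U k * U j)).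

(* Uniqueness of the morphism in the universal property follows from the
   generation clause. *)
Definition is_nctorus (R : realType) (n : nat) (theta : 'M[R]_n)
    (A : cstarAlgType R) (U : 'I_n -> A) : Prop :=
  [/\ nct_relations theta U, cstar_generates U
    & forall (B : cstarAlgType R) (V : 'I_n -> B), nct_relations theta V ->
        exists phi : A -> B, star_hom phi /\ forall j, phi (U j) = V j].

(* Integer power of a unitary, whose inverse is its adjoint. *)
Definition upow (R : realType) (A : cstarAlgType R) (u : A) (m : int) : A :=
  match m with
  | Posz p => u ^+ p
  | Negz p => star u ^+ p.+1
  end.

(* The product is taken in increasing order of the index. *)
Definition umono (R : realType) (A : cstarAlgType R) (n : nat) (U : 'I_n -> A)
    (k : 'rV[int]_n) : A :=
  \prod_(j < n) upow (U j) (k 0 j).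

Definition torus (R : realType) (n : nat) : set 'rV[R[i]]_n :=
  [set z | forall j, `|z 0 j| = 1].

(* Euclidean distance of the ambient complex space; any other usual distance on
   the torus is Lipschitz equivalent to it. *)
Definition torus_dist (R : realType) (n : nat) (z w : 'rV[R[i]]_n) : R :=
  Num.sqrt (\sum_j complex.Re `|z 0 j - w 0 j| ^+ 2).

Definition torus_action (R : realType) (A : cstarAlgType R) (n : nat)
    (U : 'I_n -> A) (act : 'rV[R[i]]_n -> A -> A) : Prop :=
  forall z, torus z ->
    star_hom (act z) /\ forall j, act z (U j) = z 0 j *: U j.

Definition is_nct_trace (R : realType) (A : cstarAlgType R) (n : nat)
    (U : 'I_n -> A) (tau : A -> R[i]) : Prop :=
  tracial_state tau /\ forall k, tau (umono U k) = (k == 0)%:R.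

Definition holder (R : realType) (A : cstarAlgType R) (n : nat)
    (act : 'rV[R[i]]_n -> A -> A) (alpha : R) : set A :=
  [set a | exists M : R, forall z w, torus z -> torus w ->
     cnorm (act z a - act w a) <= M * torus_dist z w `^ alpha].

(** * The GNS space *)

(* [T] is only constrained on the subspace [D]. *)
Definition bounded_op (R : realType) (V W : lmodType R[i])
    (D : set V) (normD : V -> R) (E : set W) (normE : W -> R) (T : V -> W)
    : Prop :=
  [/\ (forall (z : R[i]) f g, D f -> D g -> T (z *: f + g) = z *: T f + T g),
      (forall f, D f -> E (T f))
    & exists M : R, forall f, D f -> normE (T f) <= M * normD f].

(* Vectors of the GNS space are given by their coefficients in the orthonormal
   basis [umono U k]. *)
Definition l2sq (R : realType) (n : nat) (x : 'rV[int]_n -> R[i]) : \bar R :=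
  (\esum_(k in [set: 'rV[int]_n]) (complex.Re `|x k| ^+ 2)%:E)%E.

Definition l2 (R : realType) (n : nat) : set ('rV[int]_n -> R[i]) :=
  [set x | (l2sq x < +oo)%E].

Definition l2norm (R : realType) (n : nat) (x : 'rV[int]_n -> R[i]) : R :=
  Num.sqrt (fine (l2sq x)).

(* The canonical map from the algebra to its GNS space: the coefficient of [a]
   at [k] is the inner product of [umono U k] with [a]. *)
Definition gns_vec (R : realType) (A : cstarAlgType R) (n : nat)
    (U : 'I_n -> A) (tau : A -> R[i]) (a : A) : 'rV[int]_n -> R[i] :=
  fun k => tau (star (umono U k) * a).

Definition gns_left_mult (R : realType) (A : cstarAlgType R) (n : nat)
    (U : 'I_n -> A) (tau : A -> R[i])
    (lmul : A -> ('rV[int]_n -> R[i]) -> ('rV[int]_n -> R[i])) : Prop :=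
  forall a,
    bounded_op (@l2 R n) (@l2norm R n) (@l2 R n) (@l2norm R n) (lmul a) /\
    forall b, lmul a (gns_vec U tau b) = gns_vec U tau (a * b).

(** * Spinors, Sobolev spaces and the Dirac operator *)

Notation spinor R n := 'cV[R[i]]_(2 ^ n./2).

(* A family [f] of spinors stands for the sum over [k] of the elementary
   tensors of [umono U k] and [f k]. *)
Notation spinor_field R n := ('rV[int]_n -> spinor R n).

Definition spinor_norm (R : realType) (n : nat) (v : spinor R n) : R :=
  Num.sqrt (\sum_i complex.Re `|v i 0| ^+ 2).

Definition euclid_norm (R : realType) (n : nat) (xi : 'rV[R]_n) : R :=
  Num.sqrt (\sum_j xi 0 j ^+ 2).

Definition clifford_mult (R : realType) (n : nat)
    (c : 'rV[R]_n -> 'M[R[i]]_(2 ^ n./2)) : Prop :=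
  [/\ (forall (t : R) xi eta, c (t *: xi + eta) = t%:C *: c xi + c eta),
      (forall xi, (map_mx Num.conj (c xi))^T = c xi)
    & forall xi, c xi *m c xi = ((euclid_norm xi ^+ 2)%:C)%:M].

Definition freq (R : realType) (n : nat) (k : 'rV[int]_n) : 'rV[R]_n :=
  map_mx intr k.
Arguments freq R {n} k.

Definition sobolevsq (R : realType) (n : nat) (s : R) (f : spinor_field R n)
    : \bar R :=
  (\esum_(k in [set: 'rV[int]_n])
     ((1 + euclid_norm (freq R k) ^+ 2) `^ s * spinor_norm (f k) ^+ 2)%:E)%E.

(* The completion of the finitely supported families in the weighted norm is
   the weighted sequence space. *)
Definition sobolev (R : realType) (n : nat) (s : R) : set (spinor_field R n) :=
  [set f | (sobolevsq s f < +oo)%E].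

Definition sobolev_norm (R : realType) (n : nat) (s : R)
    (f : spinor_field R n) : R :=
  Num.sqrt (fine (sobolevsq s f)).

Definition L2_spinor (R : realType) (n : nat) : set (spinor_field R n) :=
  [set f | (\esum_(k in [set: 'rV[int]_n]) (spinor_norm (f k) ^+ 2)%:E
            < +oo)%E].

Definition dirac (R : realType) (n : nat)
    (c : 'rV[R]_n -> 'M[R[i]]_(2 ^ n./2)) (f : spinor_field R n)
    : spinor_field R n :=
  fun k => c (freq R k) *m f k.

Definition dirac_phase (R : realType) (n : nat)
    (c : 'rV[R]_n -> 'M[R[i]]_(2 ^ n./2)) (f : spinor_field R n)
    : spinor_field R n :=
  fun k => if k == 0 then 0
           else ((euclid_norm (freq R k))^-1)%:C *: dirac c f k.

(* The action of [a] tensored with the identity of the spinor space. *)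
Definition spinor_mult (R : realType) (A : cstarAlgType R) (n : nat)
    (lmul : A -> ('rV[int]_n -> R[i]) -> ('rV[int]_n -> R[i])) (a : A)
    (f : spinor_field R n) : spinor_field R n :=
  fun k => \col_i lmul a (fun m => f m i 0) k.

Definition phase_commutator (R : realType) (A : cstarAlgType R) (n : nat)
    (c : 'rV[R]_n -> 'M[R[i]]_(2 ^ n./2))
    (lmul : A -> ('rV[int]_n -> R[i]) -> ('rV[int]_n -> R[i])) (a : A)
    (f : spinor_field R n) : spinor_field R n :=
  dirac_phase c (spinor_mult lmul a f) - spinor_mult lmul a (dirac_phase c f).

(* Main.v *)
(** Write [a] as the kernel [A k m = <U^k, a U^m>].  Acting by the circle of the
    [l]-th coordinate multiplies this kernel by [e^(it(k_l - m_l))], so Hoelder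
    continuity bounds the commutator of [A] with the multiplier [e^(itk_l)] by
    [C |t|^alpha].  Taking [t ~ 2^-h] and linearising the exponential, the
    commutator with [k_l], cut to frequencies of size at most [2^h], is
    [O(2^(h(1 - alpha)))], hence that with [|k|^2] is [O(2^(h(2 - alpha)))].
    Between far dyadic shells [|k|^2 - |m|^2] is comparable to the larger of
    [4^h] and [4^h'], which bounds the block of [A] itself; between neighbouring
    shells one divides by [|k| + |m|] to reach the commutator with [|k|] and then
    with [k_l / |k|].  In both cases the block of [[F, a]] between the shells [h]
    and [h'] is [O(2^(- alpha max(h, h')))], and for [- alpha < s < 0] such blocks
    sum to a bounded map from [W^s] to [W^(s + alpha)].

    All estimates are made for bilinear forms over finite sets of frequencies. *)
Require Import Defs.
From mathcomp Require Import all_boot all_order all_algebra.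
From mathcomp Require Import complex.
From mathcomp Require Import all_classical all_reals all_analysis.
From mathcomp Require Import zify ring lra.

Import Order.TTheory GRing.Theory Num.Theory numFieldNormedType.Exports.

Local Open Scope classical_set_scope.
Local Open Scope complex_scope.
Local Open Scope ring_scope.

Set Implicit Arguments.
Unset Strict Implicit.
Unset Printing Implicit Defensive.

(** * Modulus of complex numbers *)

(** Working over finite sets is what makes the two inversions possible, from [e^(itk_l)] to [k_l]
    and the division by [|k| + |m|] or by [|k|^2 - |m|^2]. A finite kernel has some bound, hence a
    best one [c]; perturbing around a constant divisor gives [c <= b + q c] with [q < 1], so
    [c <= b / (1 - q)]. No Fourier or integral representation of the inverse enters.

    The algebra being abstract, the bound of the full kernel by [2 |a|] is drawn from positivity of
    the trace, by way of square roots of [1 - h]. Invariance of the trace under the action is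
    derived as well, from its values on monomials and their density.

    The range of [s] comes from the weights: they turn [2^(- alpha max(h, h'))] into
    [2^(s (h - h'))] if [h >= h'] and into [2^(- (s + alpha) (h' - h))] otherwise, and both decay
    exactly when [- alpha < s < 0]. *)

Definition cmod (R : realType) (z : R[i]) : R := complex.Re `|z|.

Section ComplexModulus.
Variable R : realType.
Implicit Types (z w : R[i]) (x y : R).

Lemma cmodE z : (cmod z)%:C = `|z|.
Proof. by rewrite /cmod normc_def. Qed.

Lemma cmod_ge0 z : 0 <= cmod z.
Proof. by rewrite /cmod normc_def /= sqrtr_ge0. Qed.

Lemma cmodM z w : cmod (z * w) = cmod z * cmod w.
Proof.
apply: (@complexI R); rewrite rmorphM /=.
by rewrite !cmodE normrM.
Qed.

Lemma cmodN z : cmod (- z) = cmod z.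
Proof. by rewrite /cmod normrN. Qed.

Lemma cmod0 : cmod (0 : R[i]) = 0.
Proof. by rewrite /cmod normr0. Qed.

Lemma cmod1 : cmod (1 : R[i]) = 1.
Proof. by rewrite /cmod normr1. Qed.

Lemma cmodD z w : cmod (z + w) <= cmod z + cmod w.
Proof. by rewrite -lecR rmorphD /= !cmodE ler_normD. Qed.

Lemma cmodB z w : cmod (z - w) <= cmod z + cmod w.
Proof. by rewrite -(cmodN w) cmodD. Qed.

Lemma cmodC z w : cmod (z - w) = cmod (w - z).
Proof. by rewrite -cmodN opprB. Qed.

Lemma cmod_sum (I : Type) (r : seq I) (P : pred I) (F : I -> R[i]) :
  cmod (\sum_(i <- r | P i) F i) <= \sum_(i <- r | P i) cmod (F i).
Proof.
elim/big_rec2: _ => [|i y z _ h]; first by rewrite cmod0.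
by apply: le_trans (cmodD _ _) _; rewrite lerD2l.
Qed.

Lemma cmod_eq0 z : cmod z = 0 -> z = 0.
Proof. by move=> h; apply/eqP; rewrite -normr_eq0 -cmodE h. Qed.

Lemma cmodR x : cmod x%:C = `|x|.
Proof. by rewrite /cmod normc_def /= expr0n addr0 sqrtr_sqr. Qed.

Lemma cmodJ z : cmod (Num.conj z) = cmod z.
Proof. by rewrite /cmod norm_conjC. Qed.

Lemma mul_conj_cmod z : Num.conj z * z = ((cmod z) ^+ 2)%:C.
Proof. by rewrite rmorphXn /= cmodE normCK mulrC. Qed.

Lemma cmod_sqr z : cmod z ^+ 2 = complex.Re z ^+ 2 + complex.Im z ^+ 2.
Proof.
by rewrite /cmod normc_def /= sqr_sqrtr // addr_ge0 ?sqr_ge0.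
Qed.

Lemma cmod_le_ReIm z : cmod z <= `|complex.Re z| + `|complex.Im z|.
Proof.
rewrite -(ler_pXn2r (n := 2)) ?nnegrE ?cmod_ge0 ?addr_ge0 //.
rewrite cmod_sqr sqrrD !real_normK ?num_real //.
by rewrite [leRHS]addrAC lerDl mulrn_wge0 // mulr_ge0.
Qed.

Lemma Re_le_cmod z : `|complex.Re z| <= cmod z.
Proof. by rewrite -lecR cmodE normc_ge_Re. Qed.

Lemma Im_le_cmod z : `|complex.Im z| <= cmod z.
Proof.
rewrite -(ler_pXn2r (n := 2)) ?nnegrE ?cmod_ge0 //.
by rewrite cmod_sqr real_normK ?num_real // lerDr sqr_ge0.
Qed.

Lemma sqr_cmodD z w : cmod (z + w) ^+ 2 <= 2 * (cmod z ^+ 2 + cmod w ^+ 2).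
Proof.
have h := cmodD z w; have := cmod_ge0 (z + w); move: h.
move: (cmod z) (cmod w) (cmod (z + w)) => a b c h1 h2.
have := sqr_ge0 (a - b).
nra.
Qed.

Lemma geometric_mean_le (a b c : R) : 0 <= a -> 0 <= b ->
  (forall t, 0 < t -> 2 * t * c <= a + t ^+ 2 * b) ->
  c <= Num.sqrt a * Num.sqrt b.
Proof.
move=> a0 b0 H.
have [c0|c0] := leP c 0; first by rewrite (le_trans c0) ?mulr_ge0 ?sqrtr_ge0.
have [b0'|b1] := leP b 0.
  have {}b0' : b = 0 by lra.
  have := H ((a + 1) / c) ltac:(by apply: divr_gt0; lra).
  rewrite b0' mulr0 addr0 -mulrA mulfVK; last by rewrite gt_eqF.
  lra.
have sb := sqr_sqrtr b0; have sa := sqr_sqrtr a0.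
have b2 : 0 < Num.sqrt b by rewrite sqrtr_gt0.
have [a0'|a1] := leP a 0.
  have {}a0' : a = 0 by lra.
  have := H (c / b) ltac:(by apply: divr_gt0; lra).
  rewrite a0' expr2 add0r.
  have -> : c / b * (c / b) * b = c / b * c by field; rewrite gt_eqF.
  have h : 0 < c / b * c by rewrite mulr_gt0 // divr_gt0.
  move: h; set w := c / b * c => h.
  have -> : 2 * (c / b) * c = 2 * w by rewrite /w; ring.
  lra.
have a2 : 0 < Num.sqrt a by rewrite sqrtr_gt0.
have := H (Num.sqrt a / Num.sqrt b) ltac:(by apply: divr_gt0; lra).
rewrite -{2}sa -{3}sb.
have -> : (Num.sqrt a / Num.sqrt b) ^+ 2 * Num.sqrt b ^+ 2 = Num.sqrt a ^+ 2.
  by field; rewrite gt_eqF.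
rewrite -mulrA => h.
have {}h : Num.sqrt a / Num.sqrt b * c <= Num.sqrt a ^+ 2 by lra.
rewrite -(ler_pM2l a2) mulrA -expr2 -ler_pdivrMr //.
by move: h; congr (_ <= _); rewrite mulrAC.
Qed.

End ComplexModulus.

(** * Positive functionals on a C*-algebra *)

Section CStarFunctionals.
Variables (R : realType) (A : cstarAlgType R).
Implicit Types (a b x y h : A) (psi : A -> R[i]).

Lemma cnorm0 : cnorm (0 : A) = 0.
Proof. by rewrite -(scale0r (0 : A)) cnormZ normr0 mul0r. Qed.

Lemma cnormN a : cnorm (- a) = cnorm a.
Proof. by rewrite -scaleN1r cnormZ normrN normr1 mul1r. Qed.

Lemma cnormB_le a b : cnorm (a - b) <= cnorm a + cnorm b.
Proof. by rewrite -(cnormN b) cnormD_le. Qed.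

Lemma cnormBC a b : cnorm (a - b) = cnorm (b - a).
Proof. by rewrite -cnormN opprB. Qed.

Lemma star1 : star (1 : A) = 1.
Proof. by rewrite -[LHS]mulr1 -{2}(starK (1 : A)) -starM mulr1 starK. Qed.

Lemma star0 : star (0 : A) = 0.
Proof. by rewrite -(scale0r (0 : A)) starZ conjC0 !scale0r. Qed.

Lemma starN a : star (- a) = - star a.
Proof. by rewrite -scaleN1r starZ rmorphN rmorph1 scaleN1r. Qed.

Lemma starB a b : star (a - b) = star a - star b.
Proof. by rewrite starD starN. Qed.

Lemma star_scale_real (t : R) a : star (t%:C *: a) = t%:C *: star a.
Proof. by rewrite starZ /=; congr (_ *: _); rewrite /Num.conj /= oppr0. Qed.

(** The C*-identity and submultiplicativity give [|b|^2 <= |star b| |b|], and [|b|] is cancelled. *)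
Lemma cnorm_star a : cnorm (star a) = cnorm a.
Proof.
suff H b : cnorm b <= cnorm (star b).
  by apply/eqP; rewrite eq_le H -{2}(starK a) H.
have [b0|b0] := ltP 0 (cnorm b).
  by rewrite -(ler_pM2r b0) -expr2 -cstar_identity cnormM_le.
by rewrite (le_trans b0) ?cnorm_ge0.
Qed.

Lemma cnorm_scale_real (t : R) a : 0 <= t -> cnorm (t%:C *: a) = t * cnorm a.
Proof. by move=> t0; rewrite cnormZ -/(cmod _) cmodR ger0_norm. Qed.

(* Visser's iteration for the square root of [1 - h]. *)
Fixpoint visser h (p : nat) : A :=
  if p is q.+1 then (2^-1)%:C *: (h + visser h q * visser h q) else 0.

Lemma half_ge0 : (0 : R) <= 2^-1. Proof. by rewrite invr_ge0. Qed.

Lemma visser_le h p : cnorm h <= 2^-1 -> cnorm (visser h p) <= 2^-1.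
Proof.
move=> hh; elim: p => [|p IH] /=; first by rewrite cnorm0 half_ge0.
rewrite cnorm_scale_real ?half_ge0 //.
have h1 := cnormD_le h (visser h p * visser h p).
have h2 := cnormM_le (visser h p) (visser h p).
have := cnorm_ge0 (visser h p); nra.
Qed.

(** The map [y |-> (h + y^2) / 2] preserves the ball of radius [1/2] and contracts distances there
    by the factor [1/2]. *)
Lemma visser_step h p : cnorm h <= 2^-1 ->
  cnorm (visser h p.+1 - visser h p) <= (2^-1) ^+ p.
Proof.
move=> hh; elim: p => [|p IH].
  rewrite /= subr0 mul0r addr0 cnorm_scale_real ?half_ge0 // expr0.
  by have := cnorm_ge0 h; lra.
rewrite [visser h p.+2]/= [X in _ - X]/= -scalerBr cnorm_scale_real ?half_ge0 //.
rewrite opprD addrACA subrr add0r.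
have -> : visser h p.+1 * visser h p.+1 - visser h p * visser h p =
    visser h p.+1 * (visser h p.+1 - visser h p) +
    (visser h p.+1 - visser h p) * visser h p.
  by rewrite mulrBr mulrBl addrA subrK.
have h1 := cnormD_le (visser h p.+1 * (visser h p.+1 - visser h p))
   ((visser h p.+1 - visser h p) * visser h p).
have h2 := cnormM_le (visser h p.+1) (visser h p.+1 - visser h p).
have h3 := cnormM_le (visser h p.+1 - visser h p) (visser h p).
have h4 := visser_le p hh; have h5 := visser_le p.+1 hh.
have := cnorm_ge0 (visser h p.+1 - visser h p).
have := cnorm_ge0 (visser h p); have := cnorm_ge0 (visser h p.+1).
rewrite exprS; move: IH h1 h2 h3 h4 h5.
set u := cnorm (visser h p); set v := cnorm (visser h p.+1).
set d := cnorm (_ - _); set e := _ ^+ p.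
move=> IH h1 h2 h3 h4 h5 v0 u0 d0.
nra.
Qed.

Lemma visser_dist h p q : cnorm h <= 2^-1 ->
  cnorm (visser h (p + q) - visser h p) <= 2 * (2^-1) ^+ p.
Proof.
move=> hh.
(* The subtracted term is the tail of the geometric series; with it the induction on [q] closes. *)
suff : cnorm (visser h (p + q) - visser h p) <=
       2 * (2^-1) ^+ p - 2 * (2^-1) ^+ (p + q).
  by have : (0 : R) <= (2^-1) ^+ (p + q); [rewrite exprn_ge0 ?half_ge0|lra].
elim: q => [|q IH]; first by rewrite addn0 !subrr cnorm0.
rewrite addnS.
have -> : visser h (p + q).+1 - visser h p =
  (visser h (p + q).+1 - visser h (p + q)) + (visser h (p + q) - visser h p).
  by rewrite addrA subrK.
apply: le_trans (cnormD_le _ _) _.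
have := visser_step (p + q) hh; rewrite [_ ^+ (_).+1]exprS; lra.
Qed.

Lemma half_pow_small (e : R) : 0 < e -> exists N : nat, (2^-1) ^+ N < e.
Proof.
move=> e0.
have [N hN] : exists N : nat, e^-1 < N%:R.
  exists (Num.truncn e^-1).+1; exact: truncnS_gt.
exists N; rewrite exprVn invf_plt ?posrE ?exprn_gt0 //.
apply: lt_trans hN _.
by rewrite -natrX ltr_nat ltn_expl.
Qed.

Lemma visser_cauchy h : cnorm h <= 2^-1 ->
  forall e : R, 0 < e -> exists N : nat, forall p q : nat,
    (N <= p)%N -> (N <= q)%N -> cnorm (visser h p - visser h q) < e.
Proof.
move=> hh e e0; have [N hN] := half_pow_small (e := e / 4) ltac:(lra).
exists N => p q Np Nq.
have -> : visser h p - visser h q =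
  (visser h p - visser h N) + (visser h N - visser h q).
  by rewrite addrA subrK.
apply: le_lt_trans (cnormD_le _ _) _; rewrite (cnormBC (visser h N)).
have := visser_dist N (p - N) hh; have := visser_dist N (q - N) hh.
rewrite !subnKC //; lra.
Qed.

Lemma visser_star h p : star h = h -> star (visser h p) = visser h p.
Proof.
move=> hs; elim: p => [|p IH] /=; first by rewrite star0.
by rewrite star_scale_real starD starM hs IH.
Qed.

Lemma cnorm_le0 a : (forall e : R, 0 < e -> cnorm a <= e) -> a = 0.
Proof.
move=> H; apply: cnorm0_eq0; apply: le_anti; rewrite cnorm_ge0 andbT.
by apply/ler_addgt0Pr => e e0; rewrite add0r H.
Qed.

(** The limit [y] of the iteration satisfies [2 y = h + y^2], so [1 - y] has square
    [1 - 2 y + y^2 = 1 - h]. *)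
Lemma sqrt_one_sub h : cnorm h <= 2^-1 -> star h = h ->
  exists2 s, star s = s & s * s = 1 - h.
Proof.
move=> hh hs.
have [y hy] := cnorm_complete _ (visser_cauchy hh).
have ys : star y = y.
  apply/eqP; rewrite -subr_eq0; apply/eqP; apply: cnorm_le0 => e e0.
  have [N hN] := hy (e / 2) ltac:(lra).
  have -> : star y - y = star (y - visser h N) + (visser h N - y).
    by rewrite starB (visser_star _ hs) addrA subrK.
  apply: le_trans (cnormD_le _ _) _; rewrite cnorm_star cnormBC.
  by have := hN N (leqnn _); lra.
have y1 : cnorm y <= 1.
  have [N hN] := hy (2^-1) ltac:(by rewrite invr_gt0).
  have -> : y = visser h N - (visser h N - y) by rewrite subKr.
  apply: le_trans (cnormB_le _ _) _.
  have := visser_le N hh; have := hN N (leqnn _); lra.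
have fix_y : y = (2^-1)%:C *: (h + y * y).
  apply/eqP; rewrite -subr_eq0; apply/eqP; apply: cnorm_le0 => e e0.
  have [N hN] := hy (e / 4) ltac:(lra).
  have -> : y - (2^-1)%:C *: (h + y * y) = (y - visser h N.+1) +
     (2^-1)%:C *: (visser h N * (visser h N - y) + (visser h N - y) * y).
    rewrite mulrBr mulrBl addrA subrK.
    rewrite [visser h N.+1]/= -addrA; congr (_ + _).
    rewrite -!scalerN -scalerDr; congr (_ *: _).
    by rewrite !opprD addrA addrNK.
  apply: le_trans (cnormD_le _ _) _.
  rewrite cnorm_scale_real ?half_ge0 // cnormBC.
  have h1 := cnormD_le (visser h N * (visser h N - y)) ((visser h N - y) * y).
  have h2 := cnormM_le (visser h N) (visser h N - y).
  have h3 := cnormM_le (visser h N - y) y.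
  have h4 := visser_le N hh.
  have h5 := hN N (leqnn _); have h6 := hN N.+1 (leqnSn _).
  have := cnorm_ge0 y; have := cnorm_ge0 (visser h N).
  have := cnorm_ge0 (visser h N - y).
  move: h1 h2 h3 h4 h5 h6 y1.
  set u := cnorm (visser h N); set v := cnorm y.
  set d := cnorm (_ - _); set d' := cnorm (visser h N.+1 - y).
  move=> h1 h2 h3 h4 h5 h6 y1 d0 u0 v0.
  nra.
exists (1 - y); first by rewrite starB star1 ys.
have {}fix_y : y + y = h + y * y.
  rewrite {1 2}fix_y -scalerDl -rmorphD /=.
  have -> : (2^-1 + 2^-1 : R) = 1 by field.
  by rewrite scale1r.
have hE : h = y + y - y * y by rewrite fix_y addrK.
by rewrite mulrBl mul1r mulrBr mulr1 hE -[in RHS]addrA !opprD !addrA.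
Qed.

Variable psi : A -> R[i].
Hypothesis psi_linear : forall (z : R[i]) a b, psi (z *: a + b) = z * psi a + psi b.

Lemma functionalD a b : psi (a + b) = psi a + psi b.
Proof. by rewrite -{1}(scale1r a) psi_linear mul1r. Qed.

Lemma functional0 : psi 0 = 0.
Proof. by apply: (addrI (psi 0)); rewrite -functionalD !addr0. Qed.

Lemma functionalZ (z : R[i]) a : psi (z *: a) = z * psi a.
Proof. by rewrite -[z *: a]addr0 psi_linear functional0 addr0. Qed.

Lemma functionalN a : psi (- a) = - psi a.
Proof. by rewrite -scaleN1r functionalZ mulN1r. Qed.

Lemma functionalB a b : psi (a - b) = psi a - psi b.
Proof. by rewrite functionalD functionalN. Qed.

Lemma functional_sum (I : Type) (r : seq I) (F : I -> A) :
  psi (\sum_(i <- r) F i) = \sum_(i <- r) psi (F i).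
Proof. exact: (big_morph psi functionalD functional0). Qed.

Hypothesis psi_pos : forall a, 0 <= psi (star a * a).

Lemma functional_pos_real a : psi (star a * a) = (complex.Re (psi (star a * a)))%:C.
Proof.
have := psi_pos a; case: (psi _) => u v; rewrite lecE /= => /andP[/eqP -> _] //.
Qed.

Lemma Re_functional_ge0 a : 0 <= complex.Re (psi (star a * a)).
Proof. by have := psi_pos a; rewrite lecE /= => /andP[]. Qed.

Lemma functional_quadratic a b (z : R[i]) :
  psi (star (a + z *: b) * (a + z *: b)) =
  psi (star a * a) + z * psi (star a * b) + Num.conj z * psi (star b * a)
    + z * Num.conj z * psi (star b * b).
Proof.
rewrite starD starZ mulrDl !mulrDr !functionalD -![in LHS]scalerAl -![in LHS]scalerAr.
by rewrite !functionalZ; ring.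
Qed.

(** Polarisation: [psi] takes real values at the squares of [a + b] and [a + i b], and the vanishing
    of the two imaginary parts determines one cross term from the other. *)
Lemma functional_hermitian a b : psi (star b * a) = Num.conj (psi (star a * b)).
Proof.
have h1 := functional_pos_real (a + 1 *: b).
have h2 := functional_pos_real (a + 'i%C *: b).
move: h1 h2; rewrite !functional_quadratic.
rewrite (functional_pos_real a) (functional_pos_real b).
case: (psi (star a * b)) => u v; case: (psi (star b * a)) => u' v'.
rewrite /Num.conj /=; simpc => -[h1] -[h2].
congr (_ +i* _)%C; lra.
Qed.

Lemma functional_CauchySchwarz a b :
  cmod (psi (star a * b)) <=
  Num.sqrt (complex.Re (psi (star a * a))) *
  Num.sqrt (complex.Re (psi (star b * b))).
Proof.
apply: geometric_mean_le; rewrite ?Re_functional_ge0 // => t t0.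
set w := psi (star a * b).
have [w0|w0] := eqVneq w 0.
  by rewrite w0 cmod0 mulr0 addr_ge0 ?Re_functional_ge0 ?mulr_ge0 ?Re_functional_ge0 ?(ltW t0).
have cw : 0 < cmod w.
  by rewrite lt_neqAle cmod_ge0 andbT eq_sym; apply/eqP => /cmod_eq0 /eqP; rewrite (negbTE w0).
(* The phase of [z] turns both cross terms into [- t |w|] and its modulus is [t], so positivity
   becomes the inequality required by [geometric_mean_le]. *)
pose z := - ((t / cmod w)%:C * Num.conj w).
have := Re_functional_ge0 (a + z *: b).
rewrite functional_quadratic (functional_hermitian a b) -/w.
have -> : z * w = - (t * cmod w)%:C.
  rewrite /z mulNr -mulrA mul_conj_cmod -rmorphM /=.
  by congr (- (_)%:C); field; rewrite gt_eqF.
have e1 : Num.conj z * Num.conj w = - (t * cmod w)%:C.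
  rewrite /z rmorphN rmorphM mulNr /= conjCK -mulrA [w * _]mulrC mul_conj_cmod.
  have -> : Num.conj ((t / cmod w)%:C) = (t / cmod w)%:C :> R[i].
    by rewrite /Num.conj /= oppr0.
  by rewrite -rmorphM /=; congr (- (_)%:C); field; rewrite gt_eqF.
have e2 : z * Num.conj z = (t ^+ 2)%:C.
  rewrite mulrC mul_conj_cmod /z cmodN cmodM cmodJ cmodR ger0_norm.
    by rewrite mulfVK // gt_eqF.
  by rewrite divr_ge0 // ltW.
rewrite e1 e2 (functional_pos_real a) (functional_pos_real b).
rewrite -!rmorphM -!rmorphN -!rmorphD /=.
lra.
Qed.

(* Norm continuity of positive functionals, with a constant 4 in place of 1 that
   keeps [star a * a], once normalised, in the range of [sqrt_one_sub]. *)
Lemma functional_bound a :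
  complex.Re (psi (star a * a)) <= 4 * cnorm a ^+ 2 * complex.Re (psi 1).
Proof.
have [a0|a0] := eqVneq (cnorm a) 0.
  by rewrite (cnorm0_eq0 _ a0) star0 mul0r functional0 cnorm0 expr0n /= mulr0 mul0r.
have ca : 0 < cnorm a by rewrite lt_neqAle eq_sym a0 cnorm_ge0.
have c2 : 0 < 4 * cnorm a ^+ 2 by rewrite mulr_gt0 ?exprn_gt0.
pose t := (4 * cnorm a ^+ 2)^-1.
have t0 : 0 <= t by rewrite invr_ge0 ltW.
have [||s ss s2] := @sqrt_one_sub (t%:C *: (star a * a)).
- rewrite cnorm_scale_real // cstar_identity /t invfM -mulrA mulVf ?mulr1 ?expf_neq0 //.
  by rewrite lef_pV2 ?posrE ?ler_nat.
- by rewrite star_scale_real starM starK.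
have := Re_functional_ge0 s; rewrite ss s2 functionalB functionalZ.
rewrite (functional_pos_real a) -rmorphM raddfB /= subr_ge0 /t mulrC.
by rewrite ler_pdivrMr // mulrC.
Qed.

End CStarFunctionals.

(** * Monomials *)

Section Monomials.
Variables (R : realType) (A : cstarAlgType R).
Implicit Types (u x y : A).

Definition quasi_commute x y := exists c : R[i], x * y = c *: (y * x).

Lemma quasi_commute_exp x y p : quasi_commute x y -> quasi_commute x (y ^+ p).
Proof.
move=> [c h]; elim: p => [|p [d IH]].
  by exists 1; rewrite expr0 mulr1 mul1r scale1r.
exists (c * d); rewrite exprS mulrA h -scalerAl -(mulrA y x) IH -scalerAr scalerA.
by rewrite mulrA.
Qed.

(** The relation for [y x] is multiplied by [star y] on both sides. *)
Lemma quasi_commute_star_r x y :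
  unitary y -> quasi_commute y x -> quasi_commute x (star y).
Proof.
move=> [y1 y2] [c h]; exists c.
have : star y * (y * x) * star y = star y * (c *: (x * y)) * star y by rewrite h.
by rewrite mulrA y1 mul1r -scalerAr -scalerAl -!mulrA y2 mulr1.
Qed.

Lemma quasi_commute_star_l x y :
  unitary x -> quasi_commute y x -> quasi_commute (star x) y.
Proof.
move=> [x1 x2] [c h]; exists c.
have : star x * (y * x) * star x = star x * (c *: (x * y)) * star x by rewrite h.
rewrite -!mulrA x2 mulr1 => ->; rewrite -scalerAl -scalerAr; congr (_ *: _).
by rewrite !mulrA x1 mul1r.
Qed.

Lemma quasi_commute_upow x y m :
  quasi_commute x y -> quasi_commute x (star y) -> quasi_commute x (upow y m).
Proof. by case: m => p h1 h2 /=; apply: quasi_commute_exp. Qed.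

Lemma upowS u m : unitary u -> u * upow u m = upow u (m + 1).
Proof.
move=> [u1 u2]; case: m => p.
  by rewrite (_ : Posz p + 1 = p.+1%:Z) ?[RHS]exprS // -addn1 PoszD.
rewrite NegzE /= exprS mulrA u2 mul1r.
have -> : (- p.+1%:Z + 1) = - p%:Z by rewrite -(addn1 p) PoszD opprD addrNK.
by case: p.
Qed.

Lemma upowP u m : unitary u -> star u * upow u m = upow u (m - 1).
Proof.
move=> hu; rewrite -{1}(subrK 1 m) -upowS // mulrA.
by case: hu => -> _; rewrite mul1r.
Qed.

Lemma star_exp u p : star (u ^+ p) = star u ^+ p.
Proof.
elim: p => [|p IH]; first by rewrite !expr0 star1.
by rewrite exprS starM IH exprSr.
Qed.

Lemma star_upow u m : star (upow u m) = upow u (- m).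
Proof.
case: m => p.
  case: p => [|p]; first by rewrite oppr0 /= expr0 star1.
  by rewrite -NegzE; apply: (star_exp u p.+1).
by rewrite [in RHS]NegzE opprK; apply: etrans (star_exp _ _) _; rewrite starK.
Qed.

Lemma unitary_upow u m : unitary u -> unitary (upow u m).
Proof.
have H (v : A) p : unitary v -> unitary (v ^+ p).
  move=> [v1 v2]; split; rewrite star_exp; elim: p => [|p IH];
    rewrite ?expr0 ?mulr1 //.
    by rewrite exprSr exprS -mulrA [star v * _]mulrA v1 mul1r.
  by rewrite exprSr exprS -mulrA [v * _]mulrA v2 mul1r.
by case: m => p hu; apply: H => //; case: hu => h1 h2; split; rewrite starK.
Qed.

Lemma unitaryM x y : unitary x -> unitary y -> unitary (x * y).
Proof.
move=> [x1 x2] [y1 y2]; split; rewrite starM.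
  by rewrite mulrA -[_ * _ * x]mulrA x1 mulr1.
by rewrite mulrA -[_ * _ * star y]mulrA y2 mulr1.
Qed.

Lemma unitary1 : unitary (1 : A).
Proof. by split; rewrite star1 mulr1. Qed.

Variables (n : nat) (theta : 'M[R]_n) (U : 'I_n -> A).
Hypothesis hU : nct_relations theta U.

Lemma unitary_umono k : unitary (umono U k).
Proof.
rewrite /umono; elim/big_ind: _ => [|x y|j _].
- exact: unitary1.
- exact: unitaryM.
- by apply: unitary_upow; case: hU.
Qed.

Lemma umono0 : umono U 0 = 1.
Proof. by rewrite /umono big1 // => j _; rewrite mxE. Qed.

(* The scalar is not recorded: only the degree matters for the trace. *)
Definition has_weight (k : 'rV[int]_n) (a : A) :=
  exists c : R[i], a = c *: umono U k.

(** [V] stands for a generator or its adjoint, with [d] equal to 1 or -1. It crosses the factors of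
    index other than [j] at the cost of scalars and is absorbed by the factor of index [j]. The list
    is an arbitrary duplicate-free one so that induction applies. *)
Lemma weight_step_seq (V : A) (j : 'I_n) (d : int) :
  (forall i m, i != j -> quasi_commute V (upow (U i) m)) ->
  (forall m, V * upow (U j) m = upow (U j) (m + d)) ->
  forall (k : 'rV[int]_n) (r : seq 'I_n), uniq r -> j \in r ->
  exists c : R[i], V * \prod_(i <- r) upow (U i) (k 0 i) =
    c *: \prod_(i <- r) upow (U i) ((k + d *: delta_mx 0 j) 0 i).
Proof.
move=> hV hj k; elim=> [//|i r IH] /= /andP[ir ur].
rewrite inE; have [ji|ij] := eqVneq j i.
  subst i => _; exists 1; rewrite scale1r !big_cons mulrA.
  have -> : V * upow (U j) (k 0 j) = upow (U j) ((k + d *: delta_mx 0 j) 0 j).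
    by rewrite hj; congr (upow _ _); rewrite !mxE !eqxx mulr1.
  congr (_ * _); apply: eq_big_seq => l lr; congr (upow _ _).
  rewrite !mxE eqxx /=; case: eqVneq lr => [->|_ _]; first by rewrite (negbTE ir).
  by rewrite mulr0 addr0.
move=> jr; have [c hc] := IH ur jr; rewrite !big_cons.
have [e he] := hV i (k 0 i) ltac:(by rewrite eq_sym).
exists (e * c); rewrite mulrA he -scalerAl -mulrA hc -scalerAr scalerA.
congr (_ *: (upow _ _ * _)); rewrite !mxE eqxx /= eq_sym (negbTE ij).
by rewrite mulr0 addr0.
Qed.

Lemma umono_weight k : has_weight k (umono U k).
Proof. by exists 1; rewrite scale1r. Qed.

Lemma weight_scale z k a : has_weight k a -> has_weight k (z *: a).
Proof. by move=> [c ->]; exists (z * c); rewrite scalerA. Qed.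

Lemma weight_step (V : A) (j : 'I_n) (d : int) :
  (forall i m, i != j -> quasi_commute V (upow (U i) m)) ->
  (forall m, V * upow (U j) m = upow (U j) (m + d)) ->
  forall k a, has_weight k a -> has_weight (k + d *: delta_mx 0 j) (V * a).
Proof.
move=> h1 h2 k _ [c ->]; rewrite -scalerAr; apply: weight_scale.
have [e he] := weight_step_seq h1 h2 k (index_enum_uniq 'I_n) (mem_index_enum j).
by exists e.
Qed.

Lemma generators_quasi_commute i j : quasi_commute (U i) (U j).
Proof. by exists (expi (theta i j)); case: hU. Qed.

Lemma weight_gen j k a : has_weight k a ->
  has_weight (k + delta_mx 0 j) (U j * a).
Proof.
have [hu _] := hU.
rewrite -(scale1r (delta_mx 0 j)); apply: weight_step => [i m _|m].
  apply: quasi_commute_upow; first exact: generators_quasi_commute.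
  by apply: quasi_commute_star_r => //; exact: generators_quasi_commute.
exact: upowS.
Qed.

Lemma weight_gen_star j k a : has_weight k a ->
  has_weight (k - delta_mx 0 j) (star (U j) * a).
Proof.
have [hu _] := hU.
rewrite -scaleN1r; apply: weight_step => [i m _|m].
  apply: quasi_commute_upow.
    by apply: quasi_commute_star_l => //; exact: generators_quasi_commute.
  apply: quasi_commute_star_l => //; apply: quasi_commute_star_l => //.
  exact: generators_quasi_commute.
exact: upowP.
Qed.

Lemma weight_upow j m k a : has_weight k a ->
  has_weight (k + m *: delta_mx 0 j) (upow (U j) m * a).
Proof.
have [hu _] := hU.
move=> ha; elim/int_rec: m => [|p IH|p IH]; first by rewrite scale0r addr0 mul1r.
  rewrite -(addn1 p) PoszD -upowS // -mulrA scalerDl scale1r addrA; exact: weight_gen.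
rewrite -(addn1 p) PoszD opprD -upowP // -mulrA scalerDl scaleN1r addrA; exact: weight_gen_star.
Qed.

Lemma row_sum_delta_seq (k : 'rV[int]_n) :
  \sum_(j < n) k 0 j *: delta_mx 0 j = k.
Proof. by rewrite -row_sum_delta. Qed.

Lemma weightM k l a b : has_weight k a -> has_weight l b ->
  has_weight (k + l) (a * b).
Proof.
move=> [c ->] hb; rewrite -scalerAl; apply: weight_scale.
rewrite -{1}(row_sum_delta_seq k) addrC /umono.
elim: (index_enum _) => [|j r IH]; first by rewrite !big_nil addr0 mul1r.
by rewrite !big_cons [_ *: _ + _]addrC addrA -mulrA; apply: weight_upow.
Qed.

Lemma weight_star k a : has_weight k a -> has_weight (- k) (star a).
Proof.
move=> [c ->]; rewrite starZ; apply: weight_scale.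
rewrite -{1}(row_sum_delta_seq k) /umono.
elim: (index_enum _) => [|j r IH].
  by rewrite !big_nil oppr0 star1 -umono0; exact: umono_weight.
rewrite !big_cons starM opprD addrC; apply: weightM => //.
rewrite star_upow -scaleNr -[upow _ _]mulr1 -[X in has_weight X _]add0r.
by apply: weight_upow; rewrite -umono0; exact: umono_weight.
Qed.

Inductive mono_span : A -> Prop :=
| mono_span_umono k : mono_span (umono U k)
| mono_span_lin z a b : mono_span a -> mono_span b -> mono_span (z *: a + b).

Lemma mono_span0 : mono_span 0.
Proof.
rewrite -(addNr (umono U 0)) -scaleN1r.
by apply: mono_span_lin; exact: mono_span_umono.
Qed.

Lemma mono_spanZ z a : mono_span a -> mono_span (z *: a).
Proof. by move=> h; rewrite -[_ *: _]addr0; apply: mono_span_lin => //; exact: mono_span0. Qed.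

Lemma weight_mono_span k a : has_weight k a -> mono_span a.
Proof. by move=> [c ->]; apply: mono_spanZ; exact: mono_span_umono. Qed.

Lemma mono_spanM a b : mono_span a -> mono_span b -> mono_span (a * b).
Proof.
move=> ha hb; elim: ha => [k|z x y _ hx _ hy]; last first.
  by rewrite mulrDl -scalerAl; exact: mono_span_lin.
elim: hb => [l|z x y _ hx _ hy]; last first.
  by rewrite mulrDr -scalerAr; exact: mono_span_lin.
by apply: weight_mono_span; apply: weightM; exact: umono_weight.
Qed.

Lemma mono_span_star a : mono_span a -> mono_span (star a).
Proof.
elim => [k|z x y _ hx _ hy]; last by rewrite starD starZ; exact: mono_span_lin.
by apply: weight_mono_span; apply: weight_star; exact: umono_weight.
Qed.

Hypothesis hgen : cstar_generates U.

(** The closure of the span of the monomials is a closed star-subalgebra containing the generators,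
    so [cstar_generates] makes it the whole algebra. *)
Lemma mono_span_dense a (e : R) : 0 < e ->
  exists2 b, mono_span b & cnorm (a - b) < e.
Proof.
pose S : set A :=
  [set a | forall e : R, 0 < e -> exists2 b, mono_span b & cnorm (a - b) < e].
suff H : S = setT by have : S a; [rewrite H|apply].
have sub b : mono_span b -> S b.
  by move=> hb r r0; exists b; rewrite // subrr cnorm0.
apply: hgen => //.
- move=> x hx r r0.
  have [y hy xy] := hx (r / 2) ltac:(lra).
  have [w hw yw] := hy (r / 2) ltac:(lra).
  exists w => //; have -> : x - w = (x - y) + (y - w) by rewrite addrA subrK.
  by apply: le_lt_trans (cnormD_le _ _) _; lra.
- by apply: sub; rewrite -umono0; exact: mono_span_umono.
- move=> z x y hx hy r r0.
  have z0 := cmod_ge0 z.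
  have [x' hx' xx'] := hx (r / 2 / (cmod z + 1)) ltac:(by apply: divr_gt0; lra).
  have [y' hy' yy'] := hy (r / 2) ltac:(lra).
  exists (z *: x' + y'); first exact: mono_span_lin.
  have -> : z *: x + y - (z *: x' + y') = z *: (x - x') + (y - y').
    by rewrite scalerBr opprD addrACA.
  apply: le_lt_trans (cnormD_le _ _) _; rewrite cnormZ -/(cmod z).
  move: xx'; rewrite ltr_pdivlMr; last lra.
  have := cnorm_ge0 (x - x'); nra.
- move=> x y hx hy r r0.
  have y0 := cnorm_ge0 y.
  have [x' hx' xx'] := hx (r / 2 / (cnorm y + 1)) ltac:(by apply: divr_gt0; lra).
  have x'0 := cnorm_ge0 x'.
  (* The tolerance for [y'] depends on the [x'] already chosen, because [x'] multiplies [y - y'] in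
     the splitting below. The added 1 avoids a division by zero. *)
  have [y' hy' yy'] := hy (r / 2 / (cnorm x' + 1)) ltac:(by apply: divr_gt0; lra).
  exists (x' * y'); first exact: mono_spanM.
  have -> : x * y - x' * y' = (x - x') * y + x' * (y - y').
    by rewrite mulrBl mulrBr addrA subrK.
  apply: le_lt_trans (cnormD_le _ _) _.
  move: xx' yy'; rewrite !ltr_pdivlMr; try lra.
  have := cnormM_le (x - x') y; have := cnormM_le x' (y - y').
  have := cnorm_ge0 (x - x'); have := cnorm_ge0 (y - y'); nra.
- move=> x hx r r0; have [y hy xy] := hx r r0.
  by exists (star y); [exact: mono_span_star|rewrite -starB cnorm_star].
- move=> j; apply: sub; apply: (@weight_mono_span (0 + delta_mx 0 j)).
  rewrite -(mulr1 (U j)); apply: weight_gen.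
  by rewrite -umono0; exact: umono_weight.
Qed.

Lemma mono_span_ext (f : A -> R[i]) (C : R) :
  (forall (z : R[i]) a b, f (z *: a + b) = z * f a + f b) ->
  (forall a, cmod (f a) <= C * cnorm a) ->
  (forall k, f (umono U k) = 0) -> forall a, f a = 0.
Proof.
move=> flin fC f0 a.
have fs b : mono_span b -> f b = 0.
  elim=> [k|z x y _ hx _ hy]; first exact: f0.
  by rewrite flin hx hy mulr0 addr0.
apply: cmod_eq0; apply: le_anti; rewrite cmod_ge0 andbT.
apply/ler_addgt0Pr => e e0; rewrite add0r.
have C0 : 0 < `|C| + 1 by rewrite ltr_wpDl.
have [b hb ab] := mono_span_dense a (e := e / (`|C| + 1)) ltac:(exact: divr_gt0).
have -> : f a = f (a - b).
  by rewrite addrC -scaleN1r flin (fs b hb) mulr0 add0r.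
apply: le_trans (fC _) _; move: ab; rewrite ltr_pdivlMr // => ab.
have := cnorm_ge0 (a - b); have := ler_norm C; nra.
Qed.

End Monomials.

(** * Matrix coefficients of Hoelder elements *)

Section PhaseFactors.
Variable R : realType.
Implicit Types s t : R.

Lemma cmod_expi t : cmod (expi t) = 1.
Proof.
apply/eqP; rewrite -(@eqrXn2 _ 2) ?cmod_ge0 //.
by rewrite cmod_sqr expr1n /= cos2Dsin2.
Qed.

Lemma expi0 : expi (0 : R) = 1.
Proof. by rewrite /expi cos0 sin0. Qed.

Lemma expiD s t : expi (s + t) = expi s * expi t.
Proof. by rewrite /expi cosD sinD; simpc; congr (_ +i* _)%C; rewrite addrC. Qed.

Lemma expi_conj t : Num.conj (expi t) = expi (- t).
Proof. by rewrite /expi cosN sinN. Qed.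

Lemma expi_natmul t p : expi (t * p%:R) = expi t ^+ p.
Proof.
elim: p => [|p IH]; first by rewrite mulr0 expi0.
by rewrite -addn1 natrD mulrDr mulr1 expiD IH addn1 exprSr.
Qed.

(** The bound on the intermediate point allows the derivative there to be estimated in turn, which
    gains further powers of [t]. *)
Lemma sin_MVT t : exists2 c, `|c| <= `|t| & sin t = cos c * t.
Proof.
have H (u : R) : 0 < u -> exists2 c, `|c| <= `|u| & sin u = cos c * u.
  move=> u0; have [|c] := @MVT R sin cos 0 u u0 (fun x _ => is_derive_sin x).
    by apply: continuous_subspaceT; exact: continuous_sin.
  rewrite in_itv /= sin0 !subr0 => /andP[c0 cu] h; exists c => //.
  by rewrite !ger0_norm ltW.
have [t0|t0|<-] := ltgtP 0 t; first exact: H.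
  have [c hc sc] := H (- t) ltac:(lra); exists c; first by rewrite -(normrN t).
  by move: sc; rewrite sinN mulrN => /oppr_inj.
by exists 0 => //; rewrite sin0 mulr0.
Qed.

Lemma cos_MVT t : exists2 c, `|c| <= `|t| & cos t - 1 = - sin c * t.
Proof.
have H (u : R) : 0 < u -> exists2 c, `|c| <= `|u| & cos u - 1 = - sin c * u.
  move=> u0; have [|c] := @MVT R cos (fun x => - sin x) 0 u u0 (fun x _ => is_derive_cos x).
    by apply: continuous_subspaceT; exact: continuous_cos.
  rewrite in_itv /= cos0 !subr0 => /andP[c0 cu] h; exists c => //.
  by rewrite !ger0_norm ltW.
have [t0|t0|<-] := ltgtP 0 t; first exact: H.
  have [c hc sc] := H (- t) ltac:(lra); exists (- c); first by rewrite normrN -(normrN t).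
  by move: sc; rewrite cosN => ->; rewrite sinN opprK mulrN mulNr opprK.
by exists 0 => //; rewrite cos0 mulr0 subrr.
Qed.

Lemma sin_norm_le t : `|sin t| <= `|t|.
Proof.
have [c _ ->] := sin_MVT t; rewrite normrM.
by rewrite ler_piMl // ler_norml cos_geN1 cos_le1.
Qed.

Lemma cos_norm_le t : `|cos t - 1| <= t ^+ 2.
Proof.
have [c ct ->] := cos_MVT t; rewrite normrM normrN -real_normK ?num_real //.
by rewrite expr2 ler_wpM2r // (le_trans (sin_norm_le c)).
Qed.

Lemma expi_sub1_linear t : cmod (expi t - 1 - (0 +i* t)%C) <= 2 * t ^+ 2 * (1 + `|t|).
Proof.
apply: le_trans (cmod_le_ReIm _) _; rewrite /= !subr0.
have h1 := cos_norm_le t.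
have [c ct sc] := sin_MVT t.
have h2 : `|sin t - t| <= t ^+ 2 * `|t|.
  rewrite sc -{2}(mul1r t) -mulrBl normrM ler_wpM2r //.
  apply: le_trans (cos_norm_le c) _.
  by rewrite -[leLHS]real_normK ?num_real // -[leRHS]real_normK ?num_real // lerXn2r ?nnegrE.
have : 0 <= t ^+ 2 * `|t| by rewrite mulr_ge0 ?sqr_ge0.
have := sqr_ge0 t; lra.
Qed.

(** In terms of the half angle, [|e^(it) - 1|^2 = 4 sin^2(t/2)]. *)
Lemma cmod_expi_sub1 t : cmod (expi t - 1) <= `|t|.
Proof.
rewrite -(ler_pXn2r (n := 2)) ?nnegrE ?cmod_ge0 // real_normK ?num_real //.
rewrite cmod_sqr /= subr0.
have -> : t = t / 2 + t / 2 by field.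
rewrite cosD sinD.
have h0 : sin (t / 2) ^+ 2 <= (t / 2) ^+ 2.
  by rewrite -[leLHS]real_normK ?num_real // -[leRHS]real_normK ?num_real //
    lerXn2r ?nnegrE ?sin_norm_le.
move: h0; have := cos2Dsin2 (t / 2).
set x := t / 2; set u := sin x; set v := cos x => h2 h1.
(* The last product vanishes since [u^2 + v^2 = 1]; keeping it makes this a polynomial identity. *)
have -> : (v * v - u * u - 1) ^+ 2 + (u * v + v * u) ^+ 2 = 4 * u ^+ 2 * (v ^+ 2 + u ^+ 2) + (v ^+ 2 + u ^+ 2 - 1) * (v ^+ 2 - 3 * u ^+ 2 - 1).
  by ring.
rewrite h2; nra.
Qed.

End PhaseFactors.

(** * Bilinear forms of kernels *)

Definition l2seq (R : realType) (I : Type) (X : seq I) (g : I -> R[i]) : R :=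
  Num.sqrt (\sum_(k <- X) cmod (g k) ^+ 2).

Definition bform (R : realType) (I : Type) (X Y : seq I) (B : I -> I -> R[i])
    (g f : I -> R[i]) : R[i] :=
  \sum_(k <- X) \sum_(m <- Y) g k * B k m * f m.

(** For duplicate-free [X] and [Y] this says that the finite matrix has operator norm at most [c];
    since [g] is arbitrary, the absence of a conjugate in [bform] makes no difference. *)
Definition kbound (R : realType) (I : Type) (X Y : seq I) (B : I -> I -> R[i])
    (c : R) : Prop :=
  forall g f, cmod (bform X Y B g f) <= c * (l2seq X g * l2seq Y f).

(** * The matrix of an element and the torus action *)

Section TorusKernel.
Variables (R : realType) (A : cstarAlgType R) (n : nat) (theta : 'M[R]_n).
Variables (U : 'I_n -> A) (tau : A -> R[i]) (act : 'rV[R[i]]_n -> A -> A).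
Hypotheses (hU : nct_relations theta U) (hgen : cstar_generates U).
Hypotheses (htau : is_nct_trace U tau) (hact : torus_action U act).

Let tau_lin : forall (z : R[i]) a b, tau (z *: a + b) = z * tau a + tau b.
Proof. by case: htau => -[]. Qed.

Let tau_pos : forall a, 0 <= tau (star a * a).
Proof. by case: htau => -[]. Qed.

Let tau1 : tau 1 = 1.
Proof. by case: htau => -[]. Qed.

Definition mcoef (a : A) (k m : 'rV[int]_n) : R[i] :=
  tau (star (umono U k) * a * umono U m).

(** The product has weight [m - k], and the trace vanishes on nonzero weights. *)
Lemma trace_orthonormal k m :
  tau (star (umono U k) * umono U m) = (k == m)%:R.
Proof.
have [<-|km] := eqVneq k m.
  by have [-> _] := unitary_umono hU k; rewrite tau1.
have [c ->] := weightM hU (weight_star hU (umono_weight U k)) (umono_weight U m).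
rewrite (functionalZ tau_lin); case: htau => _ ->.
by rewrite addrC subr_eq0 eq_sym (negbTE km) mulr0.
Qed.

Lemma functional_norm_le (psi : A -> R[i]) :
  (forall (z : R[i]) a b, psi (z *: a + b) = z * psi a + psi b) ->
  (forall a, 0 <= psi (star a * a)) -> psi 1 = 1 ->
  forall a, cmod (psi a) <= 2 * cnorm a.
Proof.
move=> plin ppos p1 a.
have := functional_CauchySchwarz plin ppos 1 a; rewrite star1 !mul1r p1 /= sqrtr1 mul1r.
move=> /le_trans; apply.
rewrite -(ler_pXn2r (n := 2)) ?nnegrE ?sqrtr_ge0 ?mulr_ge0 ?cnorm_ge0 //.
rewrite sqr_sqrtr ?Re_functional_ge0 //.
have := functional_bound plin ppos a; rewrite p1 /= mulr1 => /le_trans; apply.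
by rewrite exprMn; have -> : 4 = 2 ^+ 2 :> R by ring.
Qed.

(** The composite of [tau] with [f] is again a positive unital functional, hence bounded, and it
    agrees with [tau] on monomials. The constant 4 adds the bounds 2 of the two functionals. *)
Lemma trace_invariant (f : A -> A) : star_hom f ->
  (forall k, exists c : R[i], f (umono U k) = c *: umono U k) ->
  forall a, tau (f a) = tau a.
Proof.
move=> [flin f1 fM fs] fe a; apply/eqP; rewrite -subr_eq0; apply/eqP.
pose psi x := tau (f x).
have plin (z : R[i]) x y : psi (z *: x + y) = z * psi x + psi y.
  by rewrite /psi flin tau_lin.
have ppos x : 0 <= psi (star x * x) by rewrite /psi fM fs.
have p1 : psi 1 = 1 by rewrite /psi f1.
apply: (mono_span_ext hU hgen (f := fun x => psi x - tau x) (C := 4)).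
- by move=> z x y; rewrite plin tau_lin; ring.
- move=> x; apply: le_trans (cmodB _ _) _.
  have := functional_norm_le plin ppos p1 x.
  have := functional_norm_le tau_lin tau_pos tau1 x.
  lra.
move=> k; have [->|k0] := eqVneq k 0.
  by rewrite umono0 p1 tau1 subrr.
rewrite /psi; have [c ->] := fe k; rewrite (functionalZ tau_lin).
by case: htau => _ ->; rewrite (negbTE k0) mulr0 subrr.
Qed.

Definition circle_at (l : 'I_n) (t : R) : 'rV[R[i]]_n :=
  \row_j if j == l then expi t else 1.

Lemma torus_circle_at l t : torus (circle_at l t).
Proof.
move=> j; rewrite mxE; case: ifP => _; last by rewrite normr1.
by rewrite -cmodE cmod_expi.
Qed.

Lemma act_umono l t k : act (circle_at l t) (umono U k) =
  expi (t * (k 0 l)%:~R) *: umono U k.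
Proof.
have [[flin f1 fM fs] fU] := hact (torus_circle_at l t).
set f := act _ in flin f1 fM fs fU *.
have f0 : f 0 = 0.
  by rewrite -[X in f X](addNr (1 : A)) -scaleN1r flin scaleN1r addNr.
have fZ z x : f (z *: x) = z *: f x by rewrite -[z *: x]addr0 flin f0 addr0.
have fX x p : f (x ^+ p) = f x ^+ p.
  by elim: p => [|p IH]; rewrite ?expr0 // !exprS fM IH.
have fup j : f (upow (U j) (k 0 j)) =
    (if j == l then expi (t * (k 0 l)%:~R) else 1) *: upow (U j) (k 0 j).
  have -> : (if j == l then expi (t * (k 0 l)%:~R) else 1) =
      (if j == l then expi (t * (k 0 j)%:~R) else 1 : R[i]).
    by case: eqVneq => // ->.
  case: (k 0 j) => p /=; rewrite fX ?fs fU mxE.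
    case: eqVneq => _; last by rewrite !scale1r.
    by rewrite exprZn expi_natmul.
  case: eqVneq => _; last by rewrite !scale1r.
  by rewrite starZ exprZn expi_conj -expi_natmul NegzE mulrNz mulNr mulrN.
rewrite /umono; have -> : f (\prod_(j < n) upow (U j) (k 0 j)) =
   (\prod_(j < n) (if j == l then expi (t * (k 0 l)%:~R) else 1)) *:
   \prod_(j < n) upow (U j) (k 0 j).
  elim: (index_enum _) => [|j r IH]; first by rewrite !big_nil f1 scale1r.
  by rewrite !big_cons fM fup IH -scalerAl -scalerAr scalerA.
by rewrite -big_mkcond big_pred1_eq.
Qed.

(** By invariance of the trace the action may be applied to the whole product [star (U^k) a U^m].
    Its outer factors are eigenvectors, whose phases then pass to the other side. *)
Lemma mcoef_act l t a k m : mcoef (act (circle_at l t) a) k m =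
  expi (t * (k 0 l)%:~R) * expi (- (t * (m 0 l)%:~R)) * mcoef a k m.
Proof.
have hf := hact (torus_circle_at l t).
have inv := trace_invariant hf.1 (fun k => ex_intro _ _ (act_umono l t k)).
rewrite /mcoef -[in RHS]inv; case: hf => -[flin f1 fM fs] fU.
rewrite !fM fs !act_umono starZ expi_conj -!scalerAl -!scalerAr !(functionalZ tau_lin).
have e1 (u : R) : expi u * expi (- u) = 1 by rewrite -expiD subrr expi0.
set T := tau _; transitivity ((expi (t * (k 0 l)%:~R) * expi (- (t * (k 0 l)%:~R)))
  * (expi (t * (m 0 l)%:~R) * expi (- (t * (m 0 l)%:~R))) * T); last by ring.
by rewrite !e1 !mul1r.
Qed.

Lemma torus_dist_circle l t :
  torus_dist (circle_at l t) (circle_at l 0) <= `|t|.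
Proof.
rewrite /torus_dist (bigD1 l) // big1 => [|j jl]; last first.
  by rewrite !mxE (negbTE (jl : j != l)) subrr -/(cmod _) cmod0 expr0n.
rewrite !mxE eqxx expi0 -[X in Num.sqrt X]/(cmod (expi t - 1) ^+ 2 + 0) addr0 sqrtr_sqr ger0_norm ?cmod_ge0 //.
exact: cmod_expi_sub1.
Qed.

Lemma trace_sqr_sum (X : seq 'rV[int]_n) (f : 'rV[int]_n -> R[i]) : uniq X ->
  let y := \sum_(m <- X) f m *: umono U m in
  Num.sqrt (complex.Re (tau (star y * y))) = l2seq X f.
Proof.
move=> uX y; congr Num.sqrt.
suff -> : tau (star y * y) = (\sum_(m <- X) cmod (f m) ^+ 2)%:C by [].
have -> : star y = \sum_(m <- X) Num.conj (f m) *: star (umono U m).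
  rewrite (big_morph (@star R A) (@starD R A) (star0 A)).
  by apply: eq_bigr => m _; rewrite starZ.
rewrite mulr_suml (functional_sum tau_lin) rmorph_sum /=.
apply: eq_big_seq => m mX; rewrite mulr_sumr (functional_sum tau_lin).
rewrite (bigD1_seq m) //= big1 => [|m' m'm].
  rewrite -scalerAl -scalerAr !(functionalZ tau_lin) trace_orthonormal eqxx.
  by rewrite addr0 mulr1 mul_conj_cmod.
rewrite -scalerAl -scalerAr !(functionalZ tau_lin) trace_orthonormal.
by rewrite eq_sym (negbTE m'm) !mulr0.
Qed.

(** The form is [tau (star x a y)] for the combinations [x] and [y] of monomials below.
    Cauchy-Schwarz leaves the value at [star a a] of the positive functional
    [w |-> tau (star y w y)], which [functional_bound] estimates by [4 |a|^2 tau (star y y)]; the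
    square root gives the factor 2. *)
Lemma mcoef_kbound a (X Y : seq 'rV[int]_n) : uniq X -> uniq Y ->
  kbound X Y (mcoef a) (2 * cnorm a).
Proof.
move=> uX uY g f.
pose x := \sum_(k <- X) Num.conj (g k) *: umono U k.
pose y := \sum_(m <- Y) f m *: umono U m.
have -> : bform X Y (mcoef a) g f = tau (star x * (a * y)).
  have -> : star x = \sum_(k <- X) g k *: star (umono U k).
    rewrite (big_morph (@star R A) (@starD R A) (star0 A)).
    by apply: eq_bigr => k _; rewrite starZ conjCK.
  rewrite mulr_suml (functional_sum tau_lin); apply: eq_bigr => k _.
  rewrite /y !mulr_sumr (functional_sum tau_lin); apply: eq_bigr => m _.
  rewrite -![in RHS]scalerAr -![in RHS]scalerAl !(functionalZ tau_lin) /mcoef.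
  by rewrite -[X in tau X]mulrA; ring.
apply: le_trans (functional_CauchySchwarz tau_lin tau_pos _ _) _.
have -> : Num.sqrt (complex.Re (tau (star x * x))) = l2seq X g.
  rewrite (trace_sqr_sum _ uX) /l2seq; congr Num.sqrt.
  by apply: eq_bigr => k _; rewrite cmodJ.
rewrite -(trace_sqr_sum f uY) -/y mulrCA ler_wpM2l ?sqrtr_ge0 //.
pose psi w := tau (star y * w * y).
have plin (z : R[i]) v w : psi (z *: v + w) = z * psi v + psi w.
  by rewrite /psi mulrDr mulrDl -scalerAr -scalerAl tau_lin.
have ppos w : 0 <= psi (star w * w).
  by rewrite /psi mulrA -starM -mulrA.
have := functional_bound plin ppos a; rewrite /psi mulr1 starM !mulrA => h.
have c0 := cnorm_ge0 a.
have -> : 2 * cnorm a = Num.sqrt (4 * cnorm a ^+ 2).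
  have -> : 4 * cnorm a ^+ 2 = (2 * cnorm a) ^+ 2 by ring.
  by rewrite sqrtr_sqr ger0_norm // mulr_ge0.
rewrite -sqrtrM; last by rewrite mulr_ge0 ?sqr_ge0.
by apply: ler_wsqrtr; rewrite expr2 mulrA.
Qed.

(** The action at angle [t] minus the action at angle 0 has kernel
    [(e^(it(k_l - m_l)) - 1) mcoef a k m]. The missing factor [e^(itm_l)] is unimodular and is
    absorbed into [f]. The absolute value is there because the Hoelder constant [M] may be
    negative. *)
Lemma holder_kbound (alpha : R) a : 0 < alpha -> holder act alpha a ->
  exists2 C : R, 0 <= C & forall (l : 'I_n) (t : R) (X Y : seq 'rV[int]_n),
    uniq X -> uniq Y ->
    kbound X Y (fun k m => (expi (t * (k 0 l)%:~R) - expi (t * (m 0 l)%:~R)) *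
                           mcoef a k m) (C * `|t| `^ alpha).
Proof.
move=> alpha0 [M hM]; exists (2 * `|M|); first by rewrite mulr_ge0.
move=> l t X Y uX uY g f.
pose b := act (circle_at l t) a - act (circle_at l 0) a.
pose f' (m : 'rV[int]_n) := expi (t * (m 0 l)%:~R) * f m.
have -> : bform X Y (fun k m => (expi (t * (k 0 l)%:~R) - expi (t * (m 0 l)%:~R)) *
                           mcoef a k m) g f = bform X Y (mcoef b) g f'.
  apply: eq_bigr => k _; apply: eq_bigr => m _.
  have -> : mcoef b k m =
      mcoef (act (circle_at l t) a) k m - mcoef (act (circle_at l 0) a) k m.
    by rewrite /mcoef mulrBr mulrBl (functionalB tau_lin).
  rewrite !mcoef_act !mul0r oppr0 expi0 /f' -!mulrA; congr (_ * _).
  rewrite !mul1r; set e := expi (t * (k 0 l)%:~R); set e' := expi (t * (m 0 l)%:~R).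
  set d := expi (- _).
  have ed : d * e' = 1 by rewrite -expiD addNr expi0.
  set w := mcoef a k m; transitivity ((e * (d * e') - e') * (w * f m)); last by ring.
  by rewrite ed mulr1.
have -> : l2seq Y f = l2seq Y f'.
  congr Num.sqrt; apply: eq_bigr => m _.
  by rewrite /f' cmodM cmod_expi mul1r.
apply: le_trans (mcoef_kbound b uX uY g f') _.
apply: ler_wpM2r; first by rewrite mulr_ge0 ?sqrtr_ge0.
rewrite -mulrA ler_wpM2l //.
apply: le_trans (hM _ _ (torus_circle_at l t) (torus_circle_at l 0)) _.
apply: le_trans (_ : `|M| * torus_dist (circle_at l t) (circle_at l 0) `^ alpha <= _).
  by rewrite ler_wpM2r ?powR_ge0 ?ler_norm.
rewrite ler_wpM2l //; apply: ge0_ler_powR.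
- exact: ltW.
- by rewrite nnegrE sqrtr_ge0.
- by rewrite nnegrE.
exact: torus_dist_circle.
Qed.

End TorusKernel.

(** * Norm bounds for kernels *)

Lemma size_index_enum_ord n : size (index_enum 'I_n) = n.
Proof. by rewrite -sum1_size big_const_ord iter_addn_0 mul1n. Qed.

Section KernelBounds.
Variables (R : realType) (I : eqType) (X Y : seq I).
Implicit Types (B : I -> I -> R[i]) (g f : I -> R[i]) (c d : R).

Lemma l2seq_ge0 (Z : seq I) g : 0 <= l2seq Z g.
Proof. exact: sqrtr_ge0. Qed.

Lemma kbound_le B c c' : c <= c' -> kbound X Y B c -> kbound X Y B c'.
Proof.
move=> cc h g f; apply: le_trans (h g f) _.
by rewrite ler_wpM2r // mulr_ge0 ?l2seq_ge0.
Qed.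

Lemma kbound_ext B B' c : (forall k m, k \in X -> m \in Y -> B k m = B' k m) ->
  kbound X Y B c -> kbound X Y B' c.
Proof.
move=> e h g f; have -> : bform X Y B' g f = bform X Y B g f; last exact: h.
by apply: eq_big_seq => k kX; apply: eq_big_seq => m mY; rewrite e.
Qed.

Lemma kboundD B B' c c' : kbound X Y B c -> kbound X Y B' c' ->
  kbound X Y (fun k m => B k m + B' k m) (c + c').
Proof.
move=> h h' g f.
have -> : bform X Y (fun k m => B k m + B' k m) g f = bform X Y B g f + bform X Y B' g f.
  rewrite /bform -big_split; apply: eq_bigr => k _ /=.
  by rewrite -big_split; apply: eq_bigr => m _ /=; rewrite mulrDr mulrDl.
by apply: le_trans (cmodD _ _) _; rewrite mulrDl lerD.
Qed.

Lemma bformMl (u : I -> R[i]) B g f :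
  bform X Y (fun k m => u k * B k m) g f = bform X Y B (fun k => u k * g k) f.
Proof. by apply: eq_bigr => k _; apply: eq_bigr => m _; ring. Qed.

Lemma bformMr (u : I -> R[i]) B g f :
  bform X Y (fun k m => B k m * u m) g f = bform X Y B g (fun m => u m * f m).
Proof. by apply: eq_bigr => k _; apply: eq_bigr => m _; ring. Qed.

Lemma l2seqM (Z : seq I) (u g : I -> R[i]) r : 0 <= r ->
  (forall k, k \in Z -> cmod (u k) <= r) ->
  l2seq Z (fun k => u k * g k) <= r * l2seq Z g.
Proof.
move=> r0 ur.
rewrite /l2seq -{1}(ger0_norm r0) -sqrtr_sqr -sqrtrM ?sqr_ge0 //.
apply: ler_wsqrtr; rewrite big_distrr /= big_seq [leRHS]big_seq.
apply: ler_sum => k kZ; rewrite cmodM exprMn ler_wpM2r ?sqr_ge0 //.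
by rewrite lerXn2r ?nnegrE ?cmod_ge0 ?ur.
Qed.

Lemma kboundMl (u : I -> R[i]) B r c : 0 <= r -> 0 <= c ->
  (forall k, k \in X -> cmod (u k) <= r) -> kbound X Y B c ->
  kbound X Y (fun k m => u k * B k m) (r * c).
Proof.
move=> r0 c0 ur h g f; rewrite bformMl; apply: le_trans (h _ _) _.
rewrite -[leRHS]mulrA [leRHS]mulrCA ler_wpM2l // mulrA ler_wpM2r ?l2seq_ge0 //.
exact: l2seqM.
Qed.

Lemma kboundMr (u : I -> R[i]) B r c : 0 <= r -> 0 <= c ->
  (forall m, m \in Y -> cmod (u m) <= r) -> kbound X Y B c ->
  kbound X Y (fun k m => B k m * u m) (r * c).
Proof.
move=> r0 c0 ur h g f; rewrite bformMr; apply: le_trans (h _ _) _.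
rewrite -[leRHS]mulrA [leRHS]mulrCA ler_wpM2l // [leRHS]mulrCA.
by rewrite ler_wpM2l ?l2seq_ge0 // l2seqM.
Qed.

Lemma kboundZ (z : R[i]) B c : 0 <= c -> kbound X Y B c ->
  kbound X Y (fun k m => z * B k m) (cmod z * c).
Proof. by move=> c0; apply: kboundMl => //; exact: cmod_ge0. Qed.

Lemma kbound_sum (J : Type) (r : seq J) (B : J -> I -> I -> R[i]) c :
  (forall j, kbound X Y (B j) c) ->
  kbound X Y (fun k m => \sum_(j <- r) B j k m) ((size r)%:R * c).
Proof.
move=> h; elim: r => [|j r IH].
  move=> g f; rewrite mul0r mul0r /bform big1 ?cmod0 // => k _.
  by rewrite big1 // => m _; rewrite big_nil mulr0 mul0r.
rewrite /= -add1n natrD mulrDl mul1r.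
apply: kbound_ext (kboundD (h j) IH) => k m _ _.
by rewrite big_cons.
Qed.

Lemma cmod_le_l2seq (Z : seq I) g k : k \in Z -> cmod (g k) <= l2seq Z g.
Proof.
move=> kZ; rewrite -(ger0_norm (cmod_ge0 (g k))) -sqrtr_sqr.
apply: ler_wsqrtr; rewrite (big_rem k) //= lerDl sumr_ge0 // => i _.
exact: sqr_ge0.
Qed.

Lemma kbound_entries B (M : I -> I -> R) :
  (forall k m, k \in X -> m \in Y -> cmod (B k m) <= M k m) ->
  kbound X Y B (\sum_(k <- X) \sum_(m <- Y) M k m).
Proof.
move=> hM g f; apply: le_trans (cmod_sum _ _ _) _.
rewrite mulr_suml big_seq [leRHS]big_seq; apply: ler_sum => k kX.
apply: le_trans (cmod_sum _ _ _) _.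
rewrite mulr_suml big_seq [leRHS]big_seq; apply: ler_sum => m mY.
rewrite !cmodM mulrAC mulrC; apply: ler_pM; rewrite ?mulr_ge0 ?cmod_ge0 ?hM //.
by apply: ler_pM; rewrite ?cmod_ge0 ?cmod_le_l2seq.
Qed.

Lemma kbound_close B c : (forall e, 0 < e -> kbound X Y B (c + e)) -> kbound X Y B c.
Proof.
move=> h g f; apply/ler_addgt0Pr => e e0.
set p := l2seq X g * l2seq Y f.
have p0 : 0 <= p by rewrite mulr_ge0 ?l2seq_ge0.
have := h (e / (p + 1)) ltac:(by apply: divr_gt0; lra) g f.
rewrite -/p => /le_trans; apply; rewrite mulrDl lerD2l.
rewrite -mulrA ler_piMr //; first exact: ltW.
by rewrite mulrC ler_pdivrMr; lra.
Qed.

(** On finite sets entrywise convergence gives convergence in norm, so a bound uniform in [N] passes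
    to the limit. *)
Lemma kbound_lim B (B_ : nat -> I -> I -> R[i]) (M : I -> I -> R) c :
  (forall N, kbound X Y (B_ N) c) ->
  (forall N k m, k \in X -> m \in Y -> cmod (B k m - B_ N k m) <= M k m / N.+1%:R) ->
  kbound X Y B c.
Proof.
move=> h hM; apply: kbound_close => e e0.
pose S := \sum_(k <- X) \sum_(m <- Y) M k m.
have [N hN] : exists N : nat, `|S| / e < N.+1%:R.
  by exists (Num.truncn (`|S| / e)); exact: truncnS_gt.
have h1 := kboundD (h N) (kbound_entries (@hM N)).
apply: kbound_le (kbound_ext _ h1) => [|k m _ _]; last by rewrite addrC subrK.
rewrite lerD2l; under eq_bigr do rewrite -mulr_suml.
rewrite -mulr_suml -/S ler_pdivrMr //.
move: hN; rewrite ltr_pdivrMr // => /ltW; rewrite mulrC => hN.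
exact: le_trans (ler_norm _) hN.
Qed.

(** A best constant exists: some bound is given by [kbound_entries], and the infimum of all bounds
    is again one by [kbound_close]. The hypothesis is applied to this infimum. *)
Lemma kbound_absorb B b q : 0 <= b -> 0 <= q < 1 ->
  (forall c, 0 <= c -> kbound X Y B c -> kbound X Y B (b + q * c)) ->
  kbound X Y B (b / (1 - q)).
Proof.
move=> b0 /andP[q0 q1] h.
pose C : set R := [set c | 0 <= c /\ kbound X Y B c].
have C0 : C !=set0.
  exists (\sum_(k <- X) \sum_(m <- Y) cmod (B k m)); split.
    by do 2!(apply: sumr_ge0 => ? _); exact: cmod_ge0.
  exact: kbound_entries.
have lbC : has_lbound C by exists 0 => c [].
have infC : has_inf C by [].
have Ci : C (inf C).
  split; first by apply: lb_le_inf => // c [].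
  apply: kbound_close => e e0.
  have [c [c0 hc] ce] := inf_adherent e0 infC.
  exact: kbound_le (ltW ce) hc.
have : inf C <= b + q * inf C.
  apply: ge_inf => //; case: Ci => i0 hi; split; last exact: h.
  by rewrite addr_ge0 ?mulr_ge0.
move=> le; case: Ci => _; apply: kbound_le.
by rewrite ler_pdivlMr; nra.
Qed.

(* [(c1 + c2) D] differs from [(p k + q m) D] by a small multiple of [D]: this
   solves the Sylvester equation for [D] without any integral formula. *)
Lemma kbound_sylvester (p q : I -> R) (c1 c2 r1 r2 : R) B b : 0 <= b ->
  0 <= r1 -> 0 <= r2 -> r1 + r2 < c1 + c2 ->
  (forall k, k \in X -> `|p k - c1| <= r1) ->
  (forall m, m \in Y -> `|q m - c2| <= r2) ->
  kbound X Y (fun k m => (p k + q m)%:C * B k m) b ->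
  kbound X Y B (b / (c1 + c2 - r1 - r2)).
Proof.
move=> b0 r10 r20 rc hp hq hB.
set s := c1 + c2; have s0 : 0 < s by rewrite /s; lra.
have -> : b / (s - r1 - r2) = (b / s) / (1 - (r1 + r2) / s).
  by rewrite /s; field; apply/andP; split; rewrite gt_eqF //; lra.
apply: kbound_absorb.
- by rewrite divr_ge0 // ltW.
- apply/andP; split; first by rewrite divr_ge0 ?(ltW s0) // addr_ge0.
  by rewrite ltr_pdivrMr // mul1r.
move=> c c0 hc.
have h1 := @kboundMl (fun k => (c1 - p k)%:C) B r1 c r10 c0
  ltac:(by move=> k kX; rewrite cmodR distrC hp) hc.
have h2 := @kboundMr (fun m => (c2 - q m)%:C) B r2 c r20 c0
  ltac:(by move=> k kX; rewrite cmodR distrC hq) hc.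
have bc0 : 0 <= b + r1 * c + r2 * c by do ?[apply: addr_ge0 | apply: mulr_ge0].
have := kboundZ (s^-1)%:C bc0 (kboundD (kboundD hB h1) h2).
have -> : cmod (s^-1)%:C * (b + r1 * c + r2 * c) = b / s + (r1 + r2) / s * c.
  by rewrite cmodR ger0_norm ?invr_ge0 ?(ltW s0) //; ring.
apply: kbound_ext => k m _ _.
rewrite [_ * (c2 - q m)%:C]mulrC -!mulrDl mulrA -!rmorphD -rmorphM /=.
have -> : s^-1 * (p k + q m + (c1 - p k) + (c2 - q m)) = 1.
  by rewrite /s; field; rewrite gt_eqF.
by rewrite mul1r.
Qed.

Lemma expi_telescope (x y : R) N :
  expi (x * N%:R) - expi (y * N%:R) =
  (expi x - expi y) * \sum_(j < N) expi x ^+ (N.-1 - j) * expi y ^+ j.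
Proof. by rewrite !expi_natmul subrXX. Qed.

(* On the range of [x] all powers [expi (x k / N.+1) ^+ j] with [j <= N] stay
   within [4^-1] of [1], so the telescoping sum for the [N.+1]-st power is a
   perturbation of [N.+1] equal terms, absorbed as in [kbound_sylvester]. *)
Lemma kbound_expi_root (x : I -> R) B c N : 0 <= c ->
  (forall k, k \in X ++ Y -> `|x k| <= 4^-1) ->
  kbound X Y (fun k m => (expi (x k) - expi (x m)) * B k m) c ->
  kbound X Y (fun k m => N.+1%:R * (expi (x k / N.+1%:R) - expi (x m / N.+1%:R)) * B k m)
    (2 * c).
Proof.
move=> c0 hx h.
have N0 : (N.+1%:R : R) != 0 by [].
pose D k m := (expi (x k / N.+1%:R) - expi (x m / N.+1%:R)) * B k m.
have near1 k j : k \in X ++ Y -> (j < N.+1)%N ->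
    cmod (1 - expi (x k / N.+1%:R) ^+ j) <= 4^-1.
  move=> kXY jN; rewrite cmodC -expi_natmul.
  apply: le_trans (cmod_expi_sub1 _) _.
  apply: le_trans (hx _ kXY); rewrite -mulrA normrM ler_piMr //.
  rewrite normrM normfV !normr_nat mulrC ler_pdivrMr // mul1r ler_nat.
  exact: ltnW.
have hD : kbound X Y D (c / N.+1%:R / (1 - 2^-1)).
  apply: kbound_absorb; first by rewrite divr_ge0.
    by apply/andP; split; lra.
  move=> d d0 hd.
  (* With [e] and [e'] the two phases, [1 - e^(N - j) e'^j] is split as
     [(1 - e^(N - j)) + e^(N - j) (1 - e'^j)]; each part costs [d / 4]. *)
  have step (j : 'I_N.+1) : kbound X Y (fun k m => (1 - expi (x k / N.+1%:R) ^+ (N - j)) * D k m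
      + expi (x k / N.+1%:R) ^+ (N - j) * (D k m * (1 - expi (x m / N.+1%:R) ^+ j))) (2^-1 * d).
    have -> : 2^-1 * d = 4^-1 * d + 1 * (4^-1 * d) by field.
    apply: kboundD; first apply: kboundMl => //.
      move=> k kX; apply: near1; first by rewrite mem_cat kX.
      by rewrite ltnS leq_subr.
    apply: kboundMl => //; first by rewrite mulr_ge0.
      move=> k _; by rewrite -expi_natmul cmod_expi.
    apply: kboundMr => // m mY; apply: near1 => //.
    by rewrite mem_cat mY orbT.
  have cd0 : 0 <= c + N.+1%:R * (2^-1 * d) by rewrite addr_ge0 ?mulr_ge0.
  have := kbound_sum (index_enum 'I_N.+1) step.
  have -> : size (index_enum 'I_N.+1) = N.+1.
    exact: size_index_enum_ord.
  move=> /(kboundD h)/(kboundZ (N.+1%:R^-1)%:C cd0).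
  have -> : cmod (N.+1%:R^-1)%:C * (c + N.+1%:R * (2^-1 * d)) = c / N.+1%:R + 2^-1 * d.
    rewrite cmodR ger0_norm ?invr_ge0 //.
    by move: N0; move: (N.+1%:R : R) => v v0; field.
  apply: kbound_ext => k m _ _.
  set e := expi (x k / _); set e' := expi (x m / _).
  have := expi_telescope (x k / N.+1%:R) (x m / N.+1%:R) N.+1.
  rewrite !mulfVK // -/e -/e' => ->.
  rewrite [_ * _ * B k m]mulrAC -/(D k m) mulr_sumr -big_split /=.
  rewrite (eq_bigr (fun _ => D k m)); last by move=> j _; ring.
  rewrite sumr_const card_ord -[D k m *+ _]mulr_natl mulrA.
  have -> : (N.+1%:R^-1)%:C * N.+1%:R = 1 :> R[i].
    by rewrite -(rmorph_nat (real_complex R)) -rmorphM mulVf.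
  by rewrite mul1r.
have cN0 : 0 <= c / N.+1%:R / (1 - 2^-1) by rewrite !divr_ge0 //; lra.
have := kboundZ N.+1%:R cN0 hD.
have -> : cmod (N.+1%:R : R[i]) * (c / N.+1%:R / (1 - 2^-1)) = 2 * c.
  rewrite -(rmorph_nat (real_complex R)) cmodR ger0_norm //.
  by move: N0; move: (N.+1%:R : R) => v v0; field.
by apply: kbound_ext => k m _ _; rewrite mulrA.
Qed.

(** As [N] grows, [N (e^(ix/N) - e^(iy/N))] tends to [i (x - y)] entrywise, while [kbound_expi_root]
    bounds it by [2 c] uniformly in [N]. *)
Lemma kbound_expi_linear (x : I -> R) B c : 0 <= c ->
  (forall k, k \in X ++ Y -> `|x k| <= 4^-1) ->
  kbound X Y (fun k m => (expi (x k) - expi (x m)) * B k m) c ->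
  kbound X Y (fun k m => (x k - x m)%:C * B k m) (2 * c).
Proof.
move=> c0 hx h.
have h1 := fun N => @kbound_expi_root x B c N c0 hx h.
suff : kbound X Y (fun k m => 'i%C * ((x k - x m)%:C * B k m)) (2 * c).
  have c20 : 0 <= 2 * c by rewrite mulr_ge0.
  move=> /(kboundZ (- 'i%C) c20).
  have -> : cmod (- 'i%C : R[i]) = 1.
    by apply/eqP; rewrite -(@eqrXn2 _ 2) ?cmod_ge0 // cmod_sqr /= oppr0 expr0n /= add0r sqrrN !expr1n.
  rewrite mul1r; apply: kbound_ext => k m _ _.
  by rewrite mulrA mulNr -expr2 sqr_i opprK mul1r.
apply: (kbound_lim (M := fun k m => cmod (B k m))) h1 _ => N k m kX mY.
rewrite mulrA -mulrBl cmodM mulrC ler_wpM2l ?cmod_ge0 //.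
set y := fun k => x k / N.+1%:R.
(* With [w = x k'], the second-order estimate gives at most [4 w^2 / N.+1], and [|w| <= 1/4]. The
   limit incurs two such errors, one for [k] and one for [m]. *)
have bnd k' : k' \in X ++ Y -> cmod (N.+1%:R * (expi (y k') - 1 - (0 +i* y k')%C)) <= 2^-1 / N.+1%:R.
  move=> hk; rewrite -(rmorph_nat (real_complex R)) cmodM cmodR ger0_norm //.
  have := expi_sub1_linear (y k'); have := hx _ hk.
  rewrite /y; have N1 : 1 <= (N.+1%:R : R) by rewrite ler1n.
  set v := N.+1%:R in N1 *; set w := x k' => hw.
  have hv : w ^+ 2 <= 16^-1.
    have := normr_ge0 w; rewrite -real_normK ?num_real //; nra.
  have hv' : `|w / v| <= 1.
    by rewrite normrM normfV [`|v|]ger0_norm ?ler_pdivrMr; lra.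
  set a := cmod _ => ha.
  rewrite ler_pdivlMr; last lra.
  have e : (w / v) ^+ 2 * v ^+ 2 = w ^+ 2 by field; rewrite gt_eqF.
  have ha' : a <= 4 * (w / v) ^+ 2.
    by have := ler_wpM2l (sqr_ge0 (w / v)) hv'; move: ha; move: (_ ^+ 2) `|_| => q p; lra.
  have := ler_wpM2r (sqr_ge0 v) ha'; rewrite -mulrA e.
  have -> : v * a * v = a * v ^+ 2 by ring.
  lra.
have -> : 'i%C * (x k - x m)%:C - N.+1%:R * (expi (y k) - expi (y m)) =
  N.+1%:R * (expi (y m) - 1 - (0 +i* y m)%C) - N.+1%:R * (expi (y k) - 1 - (0 +i* y k)%C).
  have iE k' : N.+1%:R * (0 +i* y k')%C = 'i%C * (x k')%:C.
    rewrite -(rmorph_nat (real_complex R)) /y; simpc.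
    by rewrite mulrC mulfVK.
  rewrite rmorphB /= mulrBr -!iE; ring.
apply: le_trans (cmodB _ _) _.
have -> : N.+1%:R^-1 = 2^-1 / N.+1%:R + 2^-1 / N.+1%:R :> R.
  by rewrite -mulrDl (_ : 2^-1 + 2^-1 = 1) ?mul1r //; field.
by rewrite lerD // bnd // mem_cat ?kX ?mY ?orbT.
Qed.

End KernelBounds.

(** * Dyadic shells *)

Lemma exprn_powR (R : realType) (x r : R) p : 0 <= x -> (x ^+ p) `^ r = (x `^ r) ^+ p.
Proof.
move=> x0; elim: p => [|p IH]; first by rewrite !expr0 powR1.
by rewrite !exprS powRM ?IH // exprn_ge0.
Qed.

Section Shells.
Variables (R : realType) (n : nat).
Implicit Types k m : 'rV[int]_n.

Definition qnorm k : nat := \sum_j `|k 0%R j|%N ^ 2.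

(** [shell k = 0] only for [k = 0], and [shell k = h.+1] means [2^h <= |k| < 2^(h + 1)]. The squared
    norm is kept as a natural number so that [up_log] applies. *)
Definition shell k : nat := up_log 4 (qnorm k).+1.

Definition knorm k : R := euclid_norm (freq R k).

Lemma freq_sqr k j : (freq R k 0 j) ^+ 2 = (`|k 0%R j|%N ^ 2)%:R.
Proof.
rewrite mxE natrX -real_normK ?num_real //; congr (_ ^+ 2).
by rewrite natr_absz intr_norm.
Qed.

Lemma knorm_sqr k : knorm k ^+ 2 = (qnorm k)%:R.
Proof.
rewrite /knorm /euclid_norm sqr_sqrtr; last by rewrite sumr_ge0 // => j _; exact: sqr_ge0.
by rewrite natr_sum; apply: eq_bigr => j _; exact: freq_sqr.
Qed.

Lemma knorm_ge0 k : 0 <= knorm k.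
Proof. exact: sqrtr_ge0. Qed.

Lemma shell_ub k : ((qnorm k).+1 <= 4 ^ shell k)%N.
Proof. exact: up_logP. Qed.

Lemma shell_lb_strict k h : shell k = h.+1 -> (4 ^ h <= qnorm k)%N.
Proof.
move=> hk; have [q0|q0] := posnP (qnorm k).
  by move: hk; rewrite /shell q0 up_log1.
have /andP[+ _] := @up_log_bounds 4 (qnorm k).+1 isT ltac:(by rewrite ltnS).
by rewrite -/(shell k) hk ltnS.
Qed.

Lemma qnorm_lt k h : (shell k <= h)%N -> ((qnorm k)%:R : R) <= 4 ^+ h.
Proof.
move=> kh; rewrite -natrX ler_nat; apply: leq_trans (leq_pexp2l _ kh) => //.
by apply: ltnW; exact: shell_ub.
Qed.

Lemma knorm_lt k h : (shell k <= h)%N -> knorm k <= 2 ^+ h.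
Proof.
move=> kh; rewrite -(ler_pXn2r (n := 2)) ?nnegrE ?knorm_ge0 ?exprn_ge0 //.
by rewrite knorm_sqr -exprM mulnC exprM -natrX; exact: qnorm_lt.
Qed.

Lemma knorm_gt k h : (h < shell k)%N -> 2 ^+ h <= knorm k.
Proof.
move=> kh; rewrite -(ler_pXn2r (n := 2)) ?nnegrE ?knorm_ge0 ?exprn_ge0 //.
rewrite knorm_sqr -exprM mulnC exprM -natrX -natrX ler_nat.
case: (shell k) (@shell_lb_strict k) kh => // h' /(_ _ erefl) + hh'.
by apply: leq_trans; rewrite leq_exp2l.
Qed.

Lemma coord_le_knorm k l : `|(k 0 l)%:~R| <= knorm k.
Proof.
rewrite -sqrtr_sqr; apply: ler_wsqrtr.
rewrite (bigD1 l) //= mxE lerDl sumr_ge0 // => j _; exact: sqr_ge0.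
Qed.

Lemma qnorm_sum k : (qnorm k)%:R = \sum_j (k 0 j)%:~R ^+ 2 :> R.
Proof.
by rewrite natr_sum; apply: eq_bigr => j _; rewrite -freq_sqr mxE.
Qed.

(* Vanishes at [k = 0], where the division by [knorm k = 0] gives [0]. *)
Definition direction (l : 'I_n) k : R := (k 0 l)%:~R / knorm k.

Lemma direction_le1 l k : `|direction l k| <= 1.
Proof.
rewrite /direction normrM normfV (ger0_norm (knorm_ge0 k)).
have [->|k0] := eqVneq (knorm k) 0; first by rewrite invr0 mulr0.
by rewrite ler_pdivrMr ?mul1r ?coord_le_knorm // lt_neqAle eq_sym k0 knorm_ge0.
Qed.

End Shells.

(** * Commutator estimates between dyadic shells *)

Section Blocks.
Variables (R : realType) (n : nat) (B : 'rV[int]_n -> 'rV[int]_n -> R[i]).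
Variables (alpha C0 C1 : R).
Hypotheses (alpha01 : 0 < alpha < 1) (C0_ge0 : 0 <= C0) (C1_ge0 : 0 <= C1).
Hypothesis hC0 : forall X Y : seq 'rV[int]_n, uniq X -> uniq Y -> kbound X Y B C0.
Hypothesis hC1 : forall (l : 'I_n) (t : R) (X Y : seq 'rV[int]_n),
  uniq X -> uniq Y ->
  kbound X Y (fun k m => (expi (t * (k 0 l)%:~R) - expi (t * (m 0 l)%:~R)) * B k m)
    (C1 * `|t| `^ alpha).

Let rho : R := (2^-1) `^ alpha.

Lemma rho_bounds : 2^-1 <= rho <= 1.
Proof.
have h : 0 < (2^-1 : R) <= 1 by apply/andP; split; lra.
apply/andP; split.
  rewrite -{1}(powRr1 (half_ge0 R)); apply: ger_powR => //.
  by case/andP: alpha01 => _ /ltW.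
by rewrite -(powRr0 (2^-1 : R)); apply: ger_powR => //; case/andP: alpha01 => /ltW.
Qed.

Let rho_ge0 : 0 <= rho. Proof. exact: powR_ge0. Qed.

Section Bounded.
Variables (X Y : seq 'rV[int]_n) (h : nat).
Hypotheses (uX : uniq X) (uY : uniq Y).
Hypothesis hXY : forall k, k \in X ++ Y -> (shell k <= h)%N.

Lemma coord_commutator l :
  kbound X Y (fun k m => ((k 0 l)%:~R - (m 0 l)%:~R)%:C * B k m)
    (8 * C1 * rho ^+ h * 2 ^+ h).
Proof.
(* The factor [1/4] brings the phases [t k_l] into the range of [kbound_expi_linear]. Dividing by
   [t] and dropping [4^(- alpha) <= 1] leaves the constant 8, which is 4 times 2. *)
pose t : R := 4^-1 * (2^-1) ^+ h.
have t0 : 0 < t by rewrite mulr_gt0 ?invr_gt0 // exprn_gt0 // invr_gt0.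
have h1 := @hC1 l t X Y uX uY.
have c0 : 0 <= C1 * `|t| `^ alpha by rewrite mulr_ge0 ?powR_ge0.
have small k : k \in X ++ Y -> `|t * (k 0 l)%:~R| <= 4^-1.
  move=> kXY; rewrite normrM (ger0_norm (ltW t0)) /t -mulrA ler_piMr ?invr_ge0 //.
  apply: le_trans (_ : (2^-1) ^+ h * 2 ^+ h <= 1).
    rewrite ler_wpM2l ?exprn_ge0 ?invr_ge0 //.
    exact: le_trans (coord_le_knorm _ _ _) (knorm_lt _ (hXY kXY)).
  by rewrite -exprMn mulVf // expr1n.
have h2 := kbound_expi_linear c0 small h1.
have c20 : 0 <= 2 * (C1 * `|t| `^ alpha) by rewrite mulr_ge0.
have := kboundZ (t^-1)%:C c20 h2.
rewrite cmodR ger0_norm ?invr_ge0 ?(ltW t0) // => h3.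
have h4 : t^-1 * (2 * (C1 * `|t| `^ alpha)) <= 8 * C1 * rho ^+ h * 2 ^+ h.
  have -> : t^-1 = 4 * 2 ^+ h by rewrite /t invfM invrK -exprVn invrK.
  rewrite ger0_norm ?(ltW t0) // /t powRM ?invr_ge0 ?exprn_ge0 ?invr_ge0 // exprn_powR ?invr_ge0 //.
  have p1 : (4^-1 : R) `^ alpha <= 1.
    have h4 : 0 < (4^-1 : R) <= 1 by apply/andP; split; lra.
    have /andP[/ltW a0 _] := alpha01.
    by have := @ger_powR R _ h4 0 alpha a0; rewrite powRr0.
  have -> : 4 * 2 ^+ h * (2 * (C1 * (4^-1 `^ alpha * rho ^+ h))) =
     (8 * C1 * rho ^+ h * 2 ^+ h) * (4^-1) `^ alpha by ring.
  rewrite ler_piMr // !mulr_ge0 ?exprn_ge0 //.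
apply: kbound_le h4 _; apply: kbound_ext h3 => k m _ _.
rewrite mulrA -rmorphM /=; congr (_%:C * _).
by field; rewrite gt_eqF.
Qed.

(** For each coordinate [k_l^2 - m_l^2 = k_l (k_l - m_l) + (k_l - m_l) m_l], and each outer factor
    costs at most [2^h]. *)
Lemma qnorm_commutator :
  kbound X Y (fun k m => ((qnorm k)%:R - (qnorm m)%:R)%:C * B k m)
    (16 * n%:R * C1 * rho ^+ h * 4 ^+ h).
Proof.
set c := 8 * C1 * rho ^+ h * 2 ^+ h.
have c0 : 0 <= c by rewrite !mulr_ge0 ?exprn_ge0.
have p0 : (0 : R) <= 2 ^+ h by rewrite exprn_ge0.
have ub k (l : 'I_n) : k \in X ++ Y -> cmod ((k 0 l)%:~R%:C : R[i]) <= 2 ^+ h.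
  move=> kXY; rewrite cmodR.
  exact: le_trans (coord_le_knorm _ _ _) (knorm_lt _ (hXY kXY)).
have step (l : 'I_n) : kbound X Y
    (fun k m => (k 0 l)%:~R%:C * (((k 0 l)%:~R - (m 0 l)%:~R)%:C * B k m) +
     (((k 0 l)%:~R - (m 0 l)%:~R)%:C * B k m) * (m 0 l)%:~R%:C) (2 ^+ h * c + 2 ^+ h * c).
  apply: kboundD.
    apply: kboundMl => //; last exact: coord_commutator.
    by move=> k kX; apply: ub; rewrite mem_cat kX.
  have uY' (m : 'rV[int]_n) : m \in Y -> cmod ((m 0 l)%:~R%:C : R[i]) <= 2 ^+ h.
    by move=> mY; apply: ub; rewrite mem_cat mY orbT.
  exact: (kboundMr p0 c0 uY' (coord_commutator l)).
have := kbound_sum (index_enum 'I_n) step; rewrite size_index_enum_ord.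
have -> : n%:R * (2 ^+ h * c + 2 ^+ h * c) = 16 * n%:R * C1 * rho ^+ h * 4 ^+ h.
  by rewrite /c (_ : 4 = 2 * 2) ?exprMn; ring.
apply: kbound_ext => k m _ _.
rewrite !qnorm_sum -sumrB rmorph_sum mulr_suml; apply: eq_bigr => l _.
by rewrite subr_sqr rmorphM rmorphD /=; ring.
Qed.

End Bounded.

(** The constant of [qnorm_commutator] divided by the gap 3 of [far_block]; the second 16 is
    [4^(h + 2) / 4^h]. *)
Let K1 : R := 16 * n%:R * C1 * 16 / 3.

Let K1_ge0 : 0 <= K1.
Proof. by rewrite !mulr_ge0 ?invr_ge0. Qed.

Let bound_ge0 (u v : R) p q : 0 <= u -> 0 <= v ->
  0 <= u * C1 * rho ^+ p * v ^+ q.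
Proof. by move=> u0 v0; rewrite !mulr_ge0 // exprn_ge0. Qed.

Lemma far_block (X Y : seq 'rV[int]_n) h : uniq X -> uniq Y ->
  (forall k, k \in X -> shell k = h.+2) -> (forall m, m \in Y -> (shell m <= h)%N) ->
  kbound X Y B (K1 * rho ^+ h.+2).
Proof.
move=> uX uY hX hY.
have hXY k : k \in X ++ Y -> (shell k <= h.+2)%N.
  rewrite mem_cat => /orP[/hX ->//|/hY kh].
  by apply: leq_trans kh _; rewrite -addn2 leq_addr.
have M0 : (0 : R) < 4 ^+ h by rewrite exprn_gt0.
have b0 : 0 <= 16 * n%:R * C1 * rho ^+ h.+2 * 4 ^+ h.+2 by apply: bound_ge0; rewrite ?mulr_ge0.
have := qnorm_commutator uX uY hXY.
(* In units of [4^h], [|k|^2] lies in [[4, 16]], with centre 10 and radius 6, and [- |m|^2] in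
   [[-1, 0]], with centre [-1/2] and radius [1/2]. The divisor [10 - 1/2 - 6 - 1/2 = 3] is positive
   because a whole shell lies in between. *)
move=> /(@kbound_sylvester R _ X Y (fun k => (qnorm k)%:R) (fun m => - (qnorm m)%:R)
  (10 * 4 ^+ h) (- (2^-1 * 4 ^+ h)) (6 * 4 ^+ h) (2^-1 * 4 ^+ h) B _ b0).
set b := 16 * _ * _ * _ * _.
have -> : b / (10 * 4 ^+ h + - (2^-1 * 4 ^+ h) - 6 * 4 ^+ h - 2^-1 * 4 ^+ h) =
    K1 * rho ^+ h.+2.
  rewrite /b /K1 (_ : 4 ^+ h.+2 = 16 * 4 ^+ h :> R); last by rewrite !exprS; ring.
  rewrite (_ : 10 * _ + _ - _ - _ = 3 * 4 ^+ h); last by field.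
  by field; exact: lt0r_neq0.
apply.
- by rewrite mulr_ge0 // ltW.
- by rewrite mulr_ge0 ?invr_ge0 // ltW.
- lra.
- move=> k kX; have := shell_lb_strict (hX k kX).
  have := qnorm_lt R (eq_leq (hX k kX)).
  rewrite -(ler_nat R) natrX !exprS => h1 h2.
  rewrite ler_norml; apply/andP; split; lra.
- move=> m mY; have := qnorm_lt R (hY m mY); have := ler0n R (qnorm m).
  by move=> h1 h2; rewrite ler_norml; apply/andP; split; lra.
Qed.

(** The larger frequency is now [m]; the commutator changes sign so that the sum of the centres in
    [kbound_sylvester] stays positive. *)
Lemma far_block_sym (X Y : seq 'rV[int]_n) h : uniq X -> uniq Y ->
  (forall k, k \in X -> (shell k <= h)%N) -> (forall m, m \in Y -> shell m = h.+2) ->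
  kbound X Y B (K1 * rho ^+ h.+2).
Proof.
move=> uX uY hX hY.
have hXY k : k \in X ++ Y -> (shell k <= h.+2)%N.
  rewrite mem_cat => /orP[/hX kh|/hY -> //].
  by apply: leq_trans kh _; rewrite -addn2 leq_addr.
have M0 : (0 : R) < 4 ^+ h by rewrite exprn_gt0.
have b0 : 0 <= 16 * n%:R * C1 * rho ^+ h.+2 * 4 ^+ h.+2 by apply: bound_ge0; rewrite ?mulr_ge0.
have := kboundZ (- 1) b0 (qnorm_commutator uX uY hXY).
rewrite cmodN cmod1 mul1r.
move=> /(kbound_ext (B' := fun k m => (- (qnorm k)%:R + (qnorm m)%:R)%:C * B k m)).
move=> /(_ ltac:(by move=> k m _ _; rewrite mulN1r -mulNr -rmorphN /= opprB addrC)).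
move=> /(@kbound_sylvester R _ X Y (fun k => - (qnorm k)%:R) (fun m => (qnorm m)%:R)
  (- (2^-1 * 4 ^+ h)) (10 * 4 ^+ h) (2^-1 * 4 ^+ h) (6 * 4 ^+ h) B _ b0).
set b := 16 * _ * _ * _ * _.
have -> : b / (- (2^-1 * 4 ^+ h) + 10 * 4 ^+ h - 2^-1 * 4 ^+ h - 6 * 4 ^+ h) =
    K1 * rho ^+ h.+2.
  rewrite /b /K1 (_ : 4 ^+ h.+2 = 16 * 4 ^+ h :> R); last by rewrite !exprS; ring.
  rewrite (_ : - _ + _ - _ - _ = 3 * 4 ^+ h); last by field.
  by field; exact: lt0r_neq0.
apply.
- by rewrite mulr_ge0 ?invr_ge0 // ltW.
- by rewrite mulr_ge0 // ltW.
- lra.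
- move=> m mX; have := qnorm_lt R (hX m mX); have := ler0n R (qnorm m).
  by move=> h1 h2; rewrite ler_norml; apply/andP; split; lra.
- move=> k kY; have := shell_lb_strict (hY k kY).
  have := qnorm_lt R (eq_leq (hY k kY)).
  rewrite -(ler_nat R) natrX !exprS => h1 h2.
  rewrite ler_norml; apply/andP; split; lra.
Qed.

(** The factor [|k| + |m|] of [|k|^2 - |m|^2] is removed by [kbound_sylvester]. In units of [2^h]
    both norms lie in [[1, 4]], with centre [5/2] and radius [3/2], so the divisor is 2 and the
    constant is [16 * 16 / 2 = 128]. *)
Lemma knorm_commutator (X Y : seq 'rV[int]_n) h : uniq X -> uniq Y ->
  (forall k, k \in X ++ Y -> (h < shell k <= h.+2)%N) ->
  kbound X Y (fun k m => (knorm R k - knorm R m)%:C * B k m)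
    (128 * n%:R * C1 * rho ^+ h.+2 * 2 ^+ h).
Proof.
move=> uX uY hXY.
have hXY' k : k \in X ++ Y -> (shell k <= h.+2)%N by move=> /hXY /andP[].
have M0 : (0 : R) < 2 ^+ h by rewrite exprn_gt0.
have b0 : 0 <= 16 * n%:R * C1 * rho ^+ h.+2 * 4 ^+ h.+2 by apply: bound_ge0; rewrite ?mulr_ge0.
have := qnorm_commutator uX uY hXY'.
move=> /(kbound_ext (B' := fun k m => (knorm R k + knorm R m)%:C *
   ((knorm R k - knorm R m)%:C * B k m))).
move=> /(_ ltac:(by move=> k m _ _; rewrite -!knorm_sqr mulrA -rmorphM /=; congr (_%:C * _); ring)).
move=> /(@kbound_sylvester R _ X Y (knorm R (n := n)) (knorm R (n := n))
  (5 / 2 * 2 ^+ h) (5 / 2 * 2 ^+ h) (3 / 2 * 2 ^+ h) (3 / 2 * 2 ^+ h) _ _ b0).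
set b := 16 * _ * _ * _ * _.
have -> : b / (5 / 2 * 2 ^+ h + 5 / 2 * 2 ^+ h - 3 / 2 * 2 ^+ h - 3 / 2 * 2 ^+ h) =
    128 * n%:R * C1 * rho ^+ h.+2 * 2 ^+ h.
  have e : 4 ^+ h.+2 = 16 * (2 ^+ h * 2 ^+ h) :> R.
    by rewrite -exprMn (_ : 2 * 2 = 4) ?exprS; ring.
  rewrite (_ : _ + _ - _ - _ = 2 * 2 ^+ h); last by field.
  by rewrite /b e; field; exact: lt0r_neq0.
have rad k : k \in X ++ Y -> `|knorm R k - 5 / 2 * 2 ^+ h| <= 3 / 2 * 2 ^+ h.
  move=> /hXY /andP[h1 h2]; have := knorm_gt R h1; have := knorm_lt R h2.
  by rewrite !exprS => h3 h4; rewrite ler_norml; apply/andP; split; lra.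
apply; try lra.
- by move=> k kX; apply: rad; rewrite mem_cat kX.
- by move=> k kX; apply: rad; rewrite mem_cat kX orbT.
Qed.

(** The identity [k_l / |k| - m_l / |m| = |k|^(-1) ((k_l - m_l) - (|k| - |m|) m_l / |m|)] reduces
    this to the commutators with [k_l] and [|k|]. The strict lower bound on the shells excludes the
    zero frequency. *)
Lemma near_direction_commutator l (X Y : seq 'rV[int]_n) h : uniq X -> uniq Y ->
  (forall k, k \in X ++ Y -> (h < shell k <= h.+2)%N) ->
  kbound X Y (fun k m => (direction R l k - direction R l m)%:C * B k m)
    ((32 * C1 + 128 * n%:R * C1) * rho ^+ h.+2).
Proof.
move=> uX uY hXY.
have hXY' k : k \in X ++ Y -> (shell k <= h.+2)%N by move=> /hXY /andP[].
have M0 : (0 : R) < 2 ^+ h by rewrite exprn_gt0.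
have h1 := coord_commutator uX uY hXY' l.
have h2 := knorm_commutator uX uY hXY.
have b1 : 0 <= 8 * C1 * rho ^+ h.+2 * 2 ^+ h.+2 by apply: bound_ge0.
have b2 : 0 <= 128 * n%:R * C1 * rho ^+ h.+2 * 2 ^+ h by apply: bound_ge0; rewrite ?mulr_ge0.
have dY (m : 'rV[int]_n) : m \in Y -> cmod ((- direction R l m)%:C : R[i]) <= 1.
  by move=> _; rewrite cmodR normrN direction_le1.
have h3 := kboundMr ler01 b2 dY h2.
have iX (k : 'rV[int]_n) : k \in X -> cmod ((knorm R k)^-1%:C : R[i]) <= (2 ^+ h)^-1.
  move=> kX; rewrite cmodR ger0_norm ?invr_ge0 ?knorm_ge0 //.
  have /andP[hk _] := hXY k ltac:(by rewrite mem_cat kX).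
  have kg := knorm_gt R hk.
  by rewrite lef_pV2 // posrE // (lt_le_trans M0).
have i0 : 0 <= (2 ^+ h)^-1 :> R by rewrite invr_ge0 ltW.
have b3 : 0 <= 8 * C1 * rho ^+ h.+2 * 2 ^+ h.+2 + 1 * (128 * n%:R * C1 * rho ^+ h.+2 * 2 ^+ h).
  by rewrite mul1r addr_ge0.
have := kboundMl i0 b3 iX (kboundD h1 h3).
have -> : (2 ^+ h)^-1 * (8 * C1 * rho ^+ h.+2 * 2 ^+ h.+2 + 1 * (128 * n%:R * C1 * rho ^+ h.+2 * 2 ^+ h))
  = (32 * C1 + 128 * n%:R * C1) * rho ^+ h.+2.
  rewrite (_ : 2 ^+ h.+2 = 4 * 2 ^+ h :> R); last by rewrite !exprS; ring.
  by field; exact: lt0r_neq0.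
apply: kbound_ext => k m kX mY.
have nz k' : k' \in X ++ Y -> knorm R k' != 0.
  move=> /hXY /andP[hk _]; rewrite gt_eqF // (lt_le_trans M0) //; exact: knorm_gt.
have k0 := nz k ltac:(by rewrite mem_cat kX).
have m0 := nz m ltac:(by rewrite mem_cat mY orbT).
rewrite -mulrA [B k m * _]mulrC mulrA -mulrDl mulrA -!rmorphM -rmorphD -rmorphM /=.
congr (_%:C * _); rewrite /direction; field.
by rewrite k0 m0.
Qed.

Lemma direction_commutator : exists2 C : R, 0 <= C &
  forall l h h' (X Y : seq 'rV[int]_n), uniq X -> uniq Y ->
  (forall k, k \in X -> shell k = h) -> (forall m, m \in Y -> shell m = h') ->
  kbound X Y (fun k m => (direction R l k - direction R l m)%:C * B k m)
    (C * rho ^+ maxn h h').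
Proof.
have /andP[r2 r1] := rho_bounds.
pose K2 : R := 32 * C1 + 128 * n%:R * C1.
have K20 : 0 <= K2 by rewrite addr_ge0 ?mulr_ge0.
exists (4 * C0 + 2 * K1 + K2); first by rewrite !addr_ge0 ?mulr_ge0.
have le_sum (x y z : R) : 0 <= x -> 0 <= y -> 0 <= z ->
    [/\ y <= x + y + z, x <= x + y + z & z <= x + y + z].
  by move=> x0 y0 z0; split; lra.
have c40 : 0 <= 4 * C0 by rewrite mulr_ge0.
have k20 : 0 <= 2 * K1 by rewrite mulr_ge0.
have [S1 S2 S3] := le_sum _ _ _ c40 k20 K20.
move=> l h h' X Y uX uY hX hY.
(* Directions are bounded by 1, so a bound on the block itself suffices; this serves the far blocks
   and the lowest shells. *)
have trivial_bound c : 0 <= c -> kbound X Y B c ->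
    kbound X Y (fun k m => (direction R l k - direction R l m)%:C * B k m) (2 * c).
  move=> c0 hc; have -> : 2 * c = 1 * c + 1 * c by ring.
  apply: kbound_ext (kboundD
    (kboundMl (u := fun k => (direction R l k)%:C) ler01 c0 _ hc)
    (kboundMr (u := fun m => (- direction R l m)%:C) ler01 c0 _ hc)).
  - by move=> k m _ _; rewrite rmorphN rmorphB /=; ring.
  - by move=> k _; rewrite cmodR direction_le1.
  - by move=> k _; rewrite cmodR normrN direction_le1.
have re p : 0 <= rho ^+ p by rewrite exprn_ge0.
have up c p : 0 <= c -> c <= 4 * C0 + 2 * K1 + K2 -> (maxn h h' <= p)%N ->
    kbound X Y (fun k m => (direction R l k - direction R l m)%:C * B k m) (c * rho ^+ p) ->
    kbound X Y (fun k m => (direction R l k - direction R l m)%:C * B k m)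
     ((4 * C0 + 2 * K1 + K2) * rho ^+ maxn h h').
  move=> c0 cC hp; apply: kbound_le; apply: ler_pM => //.
  by apply: ler_wiXn2l.
have [hh|hh] := leqP h'.+2 h.
  apply: (up (2 * K1) h) => //.
    by rewrite geq_max leqnn /= (leq_trans _ hh) // -addn2 leq_addr.
  rewrite -mulrA; apply: trivial_bound; first by rewrite mulr_ge0.
  case: h hh hX up => [//|[//|p]] hh hX up; apply: far_block => // m /hY ->.
  by rewrite -ltnS -[p.+1]/(p.+2.-1).
have [hh'|hh'] := leqP h.+2 h'.
  apply: (up (2 * K1) h') => //.
    by rewrite geq_max leqnn andbT (leq_trans _ hh') // -addn2 leq_addr.
  rewrite -mulrA; apply: trivial_bound; first by rewrite mulr_ge0.
  by case: h' hh' hY up {hh} => [//|[//|p]] hh hY up; apply: far_block_sym => // m /hX ->.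
(* Only shells 0 and 1 occur here, possibly with the zero frequency; [rho >= 1/2] gives
   [2 C0 <= 4 C0 rho]. *)
have [small|large] := leqP (maxn h h') 1.
  apply: (up (4 * C0) 1%N) => //.
  apply: kbound_le (trivial_bound _ C0_ge0 (hC0 uX uY)).
  by rewrite expr1; nra.
pose p := (maxn h h').-2.
(* The two shells differ by at most one, so both are [p.+1] or [p.+2]. *)
have mp : maxn h h' = p.+2 by rewrite /p; case: (maxn h h') large => [|[]].
apply: (up K2 p.+2); rewrite ?mp //.
apply: near_direction_commutator => // k; rewrite mem_cat => kXY.
have : (shell k == h) || (shell k == h').
  by case/orP: kXY => [/hX|/hY] ->; rewrite eqxx ?orbT.
move: (shell k) mp hh hh'; move: p => p; clear => e mp hh hh'.
by case/orP => /eqP ->; lia.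
Qed.

End Blocks.

(** * Summation over shells *)

Section SchurSum.
Variable R : realType.

(** Subtraction being truncated, the exponent is [|h - i|], and the sum is part of a two-sided
    geometric series. *)
Lemma geometric_dist_sum (q : R) h N : 0 <= q < 1 ->
  \sum_(i < N) q ^+ ((h - i) + (i - h)) <= 2 / (1 - q).
Proof.
move=> /andP[q0 q1]; have q1' : 0 < 1 - q by lra.
(* The bound [2 - q^h] is the one that induction on [h] reproduces: the step amounts to
   [0 <= q^h (1 - q)^2]. *)
rewrite ler_pdivlMr //; suff : (\sum_(i < N) q ^+ ((h - i) + (i - h))) * (1 - q) <= 2 - q ^+ h.
  by have : 0 <= q ^+ h; [rewrite exprn_ge0|lra].
elim: h N => [|h IH] N.
  under eq_bigr do rewrite sub0n add0n subn0.
  rewrite mulrC -[X in X <= _]opprK -mulNr opprB -subrX1 opprB.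
  by have : 0 <= q ^+ N; [rewrite exprn_ge0|rewrite expr0; lra].
have qh : 0 <= q ^+ h by rewrite exprn_ge0.
case: N => [|N].
  rewrite big_ord0 mul0r subr_ge0 (le_trans (exprn_ile1 _ _ _)) //; [exact: ltW|lra].
rewrite big_ord_recl /= subn0 sub0n addn0.
under eq_bigr do rewrite /bump /= add1n !subSS.
have := IH N; have := mulr_ge0 qh (sqr_ge0 (1 - q)); rewrite mulrDl [q ^+ h.+1]exprS.
by move: (\sum_(i < N) _) (q ^+ h) => x y; lra.
Qed.

Variable n : nat.
Implicit Types (k m : 'rV[int]_n) (X Y : seq 'rV[int]_n).

Definition sweight (s : R) k : R := (1 + euclid_norm (freq R k) ^+ 2) `^ s.

Lemma sweight_ge0 s k : 0 <= sweight s k.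
Proof. exact: powR_ge0. Qed.

Lemma shell_base k : 0 < 1 + euclid_norm (freq R k) ^+ 2 <= 4 ^+ shell k.
Proof.
rewrite -/(knorm R k) knorm_sqr addrC natr1 ltr0n /= -natrX ler_nat.
exact: shell_ub.
Qed.

(** For [s <= 0] the weight decreases in [|k|], so the upper end of a shell gives a lower bound
    [4^(s h)]. Both weights of [weighted_schur] have negative exponent, so this one-sided comparison
    suffices. *)
Lemma sweight_lb (s : R) k : s <= 0 -> (2 `^ s) ^+ shell k ^+ 2 <= sweight s k.
Proof.
move=> s0; have /andP[x0 x4] := shell_base k; rewrite /sweight.
set x := 1 + _ in x0 x4 *.
have -> : (2 `^ s) ^+ shell k ^+ 2 = ((4 ^+ shell k) `^ (- s))^-1.
  rewrite -powRN opprK exprn_powR // -exprM mulnC exprM -exprn_powR //.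
  by rewrite (_ : 2 ^+ 2 = 4 :> R) //; ring.
have -> : x `^ s = (x `^ (- s))^-1 by rewrite -powRN opprK.
rewrite lef_pV2 ?posrE ?powR_gt0 ?exprn_gt0 //.
by apply: ge0_ler_powR => //; rewrite ?nnegrE ?oppr_ge0 // ?ltW // exprn_gt0.
Qed.

Lemma sum_by_shell (V : nmodType) X N (F : 'rV[int]_n -> V) :
  (forall k, k \in X -> (shell k < N)%N) ->
  \sum_(k <- X) F k = \sum_(h < N) \sum_(k <- [seq k <- X | shell k == h]) F k.
Proof.
move=> hN.
transitivity (\sum_(h < N) \sum_(k <- X) if shell k == h then F k else 0); last first.
  by apply: eq_bigr => h _; rewrite big_filter [RHS]big_mkcond.
rewrite exchange_big /=; apply: eq_big_seq => k kX.
by rewrite -big_mkcond (big_pred1 (Ordinal (hN k kX))).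
Qed.

Lemma shell_bounded X : exists N, forall k, k \in X -> (shell k < N)%N.
Proof.
elim: X => [|k X [N IH]]; first by exists 0%N.
exists (maxn N (shell k).+1) => m; rewrite inE => /orP[/eqP ->|/IH h].
  by rewrite leq_max leqnn orbT.
by rewrite leq_max h.
Qed.

Lemma l2seq_shell X (s : R) h g : s <= 0 -> (forall k, k \in X -> shell k = h) ->
  l2seq X g <= (2 `^ s) ^- h * Num.sqrt (\sum_(k <- X) sweight s k * cmod (g k) ^+ 2).
Proof.
move=> s0 hX; have b0 : 0 < (2 `^ s : R) by rewrite powR_gt0.
rewrite mulrC ler_pdivlMr ?exprn_gt0 //.
rewrite -(ger0_norm (exprn_ge0 h (ltW b0))) -sqrtr_sqr -sqrtrM; last first.
  by rewrite sumr_ge0 // => k _; exact: sqr_ge0.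
apply: ler_wsqrtr; rewrite mulr_suml big_seq [leRHS]big_seq; apply: ler_sum => k kX.
by rewrite mulrC ler_wpM2r ?sqr_ge0 // -(hX k kX) sweight_lb.
Qed.

(** Schur's test over the shells. With [a = 2^(- (s + alpha))] and [b = 2^s] one has
    [2^(- alpha) = a b], and undoing the weights costs [a^(- h) b^(- h')]; what remains is
    [b^(h - h')] or [a^(h' - h)], at most [q^|h - h'|] with [q < 1]. The conclusion has a sum in
    place of a product of norms so that it can be added up over coordinates and spinor
    components. *)
Lemma weighted_schur (B : 'rV[int]_n -> 'rV[int]_n -> R[i]) (alpha s C : R) :
  0 <= C -> - alpha < s < 0 ->
  (forall h h' X Y, uniq X -> uniq Y ->
    (forall k, k \in X -> shell k = h) -> (forall m, m \in Y -> shell m = h') ->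
    kbound X Y B (C * ((2^-1) `^ alpha) ^+ maxn h h')) ->
  exists2 C' : R, 0 <= C' & forall X Y g f, uniq X -> uniq Y ->
    2 * cmod (bform X Y B g f) <=
    C' * (\sum_(k <- X) sweight (- (s + alpha)) k * cmod (g k) ^+ 2 +
          \sum_(m <- Y) sweight s m * cmod (f m) ^+ 2).
Proof.
move=> C0 /andP[sa s0] hB.
set u := - (s + alpha); have u0 : u < 0 by rewrite /u; lra.
pose a : R := 2 `^ u; pose b : R := 2 `^ s.
have a0 : 0 < a by rewrite powR_gt0.
have b0 : 0 < b by rewrite powR_gt0.
have lt1 (v : R) : v < 0 -> 2 `^ v < 1 :> R.
  move=> v0; rewrite -(opprK v) powRN invf_lt1 ?powR_gt0 //.
  have nv : 0 < - v by rewrite oppr_gt0.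
  have := @gt0_ltr_powR R _ nv 1 2; rewrite !nnegrE powR1; apply => //.
  by rewrite ltr1n.
have a1 : a < 1 by exact: lt1.
have b1 : b < 1 by exact: lt1.
have rhoE : (2^-1) `^ alpha = a * b :> R.
  rewrite /a /b -powRD ?pnatr_eq0 ?implybT // /u opprD addrAC addNr add0r.
  by rewrite -powR_inv1 // -powRrM mulN1r.
pose q := Num.max a b.
have q01 : 0 <= q < 1 by rewrite le_max (ltW a0) gt_max a1 b1.
have q1 : 0 < 1 - q by case/andP: q01; lra.
have [q0 _] := andP q01.
exists (C * (2 / (1 - q))); first by rewrite mulr_ge0 // divr_ge0 // ltW.
move=> X Y g f uX uY.
have [N1 hN1] := shell_bounded X; have [N2 hN2] := shell_bounded Y.
pose N := maxn N1 N2.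
have hX k : k \in X -> (shell k < N)%N by move/hN1 => h; rewrite leq_max h.
have hY k : k \in Y -> (shell k < N)%N by move/hN2 => h; rewrite leq_max h orbT.
pose Xs (h : 'I_N) := [seq k <- X | shell k == h].
pose Ys (h : 'I_N) := [seq k <- Y | shell k == h].
pose G h := Num.sqrt (\sum_(k <- Xs h) sweight u k * cmod (g k) ^+ 2).
pose F h := Num.sqrt (\sum_(m <- Ys h) sweight s m * cmod (f m) ^+ 2).
have G2 h : G h ^+ 2 = \sum_(k <- Xs h) sweight u k * cmod (g k) ^+ 2.
  by rewrite sqr_sqrtr // sumr_ge0 // => k _; rewrite mulr_ge0 ?sweight_ge0 ?sqr_ge0.
have F2 h : F h ^+ 2 = \sum_(m <- Ys h) sweight s m * cmod (f m) ^+ 2.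
  by rewrite sqr_sqrtr // sumr_ge0 // => k _; rewrite mulr_ge0 ?sweight_ge0 ?sqr_ge0.
have inXs h k : k \in Xs h -> shell k = h by rewrite mem_filter => /andP[/eqP].
have inYs h k : k \in Ys h -> shell k = h by rewrite mem_filter => /andP[/eqP].
have block (h h' : 'I_N) : cmod (bform (Xs h) (Ys h') B g f) <=
    C * q ^+ ((h - h') + (h' - h)) * (G h * F h').
  have := @hB h h' (Xs h) (Ys h') (filter_uniq _ uX) (filter_uniq _ uY)
    (@inXs h) (@inYs h') g f.
  move=> /le_trans; apply.
  have gl := l2seq_shell (s := u) g (ltW u0) (@inXs h).
  have fl := l2seq_shell (s := s) f (ltW s0) (@inYs h').
  rewrite -!mulrA ler_wpM2l // rhoE.
  apply: (@le_trans _ _ ((a * b) ^+ maxn h h' * ((a ^- h * G h) * (b ^- h' * F h')))).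
    rewrite ler_wpM2l ?exprn_ge0 ?mulr_ge0 ?(ltW a0) ?(ltW b0) //.
    by apply: ler_pM => //; exact: l2seq_ge0.
  have -> : (a * b) ^+ maxn h h' * ((a ^- h * G h) * (b ^- h' * F h')) =
     ((a * b) ^+ maxn h h' * a ^- h * b ^- h') * (G h * F h') by ring.
  rewrite ler_wpM2r ?mulr_ge0 ?sqrtr_ge0 //.
  have [hh|hh] := leqP h' h.
    rewrite (eqP (hh : h' - h == 0)%N) addn0.
    have -> : (a * b) ^+ h * a ^- h * b ^- h' = b ^+ (h - h').
      rewrite -{1}(subnK hh) exprMn [b ^+ (_ + _)]exprD.
      by rewrite subnK //; field; rewrite !expf_neq0 ?gt_eqF.
    by rewrite lerXn2r ?nnegrE ?(ltW b0) // le_max lexx orbT.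
  have hh1 := ltnW hh.
  rewrite (eqP (hh1 : h - h' == 0)%N) add0n.
  have -> : (a * b) ^+ h' * a ^- h * b ^- h' = a ^+ (h' - h).
    rewrite -{1}(subnK hh1) exprMn [a ^+ (_ + _)]exprD.
    by rewrite subnK //; field; rewrite !expf_neq0 ?gt_eqF.
  by rewrite lerXn2r ?nnegrE ?(ltW a0) // le_max lexx.
have -> : bform X Y B g f = \sum_(h < N) \sum_(h' < N) bform (Xs h) (Ys h') B g f.
  rewrite /bform (sum_by_shell _ hX); apply: eq_bigr => h _.
  rewrite [RHS]exchange_big /=; apply: eq_bigr => k _.
  by rewrite (sum_by_shell _ hY).
rewrite (sum_by_shell _ hX) (sum_by_shell _ hY).
under [in leRHS]eq_bigr do rewrite -G2.
under [X in _ <= _ * (_ + X)]eq_bigr do rewrite -F2.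
apply: (@le_trans _ _ (\sum_(h < N) \sum_(h' < N)
   (C * q ^+ ((h - h') + (h' - h)) * (G h ^+ 2 + F h' ^+ 2)))).
  apply: le_trans (_ : 2 * (\sum_(h < N) \sum_(h' < N) C * q ^+ ((h - h') + (h' - h)) * (G h * F h')) <= _).
    rewrite ler_wpM2l //; apply: le_trans (cmod_sum _ _ _) _.
    apply: ler_sum => h _; apply: le_trans (cmod_sum _ _ _) _.
    by apply: ler_sum => h' _; exact: block.
  rewrite mulr_sumr; apply: ler_sum => h _; rewrite mulr_sumr; apply: ler_sum => h' _.
  rewrite mulrCA ler_wpM2l ?mulr_ge0 ?exprn_ge0 //.
  by have := sqr_ge0 (G h - F h'); rewrite sqrrB; lra.
have -> : \sum_(h < N) \sum_(h' < N)
   (C * q ^+ ((h - h') + (h' - h)) * (G h ^+ 2 + F h' ^+ 2)) =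
  C * (\sum_(h < N) G h ^+ 2 * (\sum_(h' < N) q ^+ ((h - h') + (h' - h))) +
       \sum_(h' < N) F h' ^+ 2 * (\sum_(h < N) q ^+ ((h' - h) + (h - h')))).
  under [X in _ = _ * (_ + X)]eq_bigr do rewrite mulr_sumr.
  rewrite [X in _ = _ * (_ + X)]exchange_big /= -big_split mulr_sumr /=.
  apply: eq_bigr => h _; rewrite mulr_sumr -big_split mulr_sumr /=.
  by apply: eq_bigr => h' _; rewrite [(h' - h + _)%N]addnC; ring.
rewrite -mulrA ler_wpM2l // mulrDr; apply: lerD.
  rewrite mulr_sumr; apply: ler_sum => h _.
  by rewrite mulrC ler_wpM2r ?sqr_ge0 // geometric_dist_sum.
rewrite mulr_sumr; apply: ler_sum => h _.
by rewrite mulrC ler_wpM2r ?sqr_ge0 // geometric_dist_sum.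
Qed.

End SchurSum.

(** * Limits along an enumeration *)

Section FamilySums.
Variables (R : realType) (I : countType).
Implicit Types (u : I -> R) (X : seq I).

Definition enumseq N : seq I := pmap pickle_inv (iota 0 N).

Lemma enumseq_uniq N : uniq (enumseq N).
Proof. by apply: (pmap_uniq (@pickle_invK I)); exact: iota_uniq. Qed.

Lemma enumseq_catP N N' : (N <= N')%N -> exists Z, [/\ enumseq N' = enumseq N ++ Z,
  uniq Z & forall k, k \in Z -> (N <= pickle k)%N].
Proof.
move=> NN; exists (pmap pickle_inv (iota N (N' - N))); split.
- by rewrite /enumseq -pmap_cat -[N in iota N _]add0n -iotaD subnKC.
- by apply: (pmap_uniq (@pickle_invK I)); exact: iota_uniq.
move=> k; rewrite mem_pmap => /mapP[p]; rewrite mem_iota => /andP[Np _] h.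
by have := pickle_invK (T := I) p; rewrite -h /= => ->.
Qed.

Lemma mem_enumseq N k : (pickle k < N)%N -> k \in enumseq N.
Proof.
move=> kN; rewrite mem_pmap; apply/mapP; exists (pickle k).
  by rewrite mem_iota.
by rewrite pickleK_inv.
Qed.

Lemma esum_le_bound u (c : R) : (forall X, uniq X -> \sum_(k <- X) u k <= c) ->
  (\esum_(k in [set: I]) (u k)%:E <= c%:E)%E.
Proof.
move=> h; apply: ub_ereal_sup => _ [F [fF _] <-].
by rewrite fsbig_finite //= sumEFin lee_fin h //; exact: finmap.fset_uniq.
Qed.

Variable u : I -> R.
Hypothesis u_ge0 : forall k, 0 <= u k.
Hypothesis u_fin : (\esum_(k in [set: I]) (u k)%:E < +oo)%E.

Lemma fine_esumK :
  (fine (\esum_(k in [set: I]) (u k)%:E))%:E = (\esum_(k in [set: I]) (u k)%:E)%E.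
Proof.
apply: fineK; rewrite ge0_fin_numE //.
by apply: esum_ge0 => k _; rewrite lee_fin.
Qed.

Lemma sum_le_esum X : uniq X ->
  \sum_(k <- X) u k <= fine (\esum_(k in [set: I]) (u k)%:E).
Proof.
move=> uX; rewrite -lee_fin fine_esumK; apply: esum_ge.
exists [set` X]; first by split => //; exact: finite_seq.
by rewrite -fsbig_seq //= sumEFin.
Qed.

(** A finite set whose sum is within [e] of the total leaves at most [e] to any finite set disjoint
    from it. *)
Lemma sum_tail_small (e : R) : 0 < e -> exists N, forall X, uniq X ->
  (forall k, k \in X -> (N <= pickle k)%N) -> \sum_(k <- X) u k <= e.
Proof.
move=> e0; set S := fine (\esum_(k in [set: I]) (u k)%:E).
have [X0 uX0 hX0] : exists2 X0, uniq X0 & S - e < \sum_(k <- X0) u k.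
  apply: contrapT => /forall2NP H.
  have : (\esum_(k in [set: I]) (u k)%:E <= (S - e)%:E)%E.
    apply: esum_le_bound => X uX; have [//|/negP] := H X.
    by rewrite -leNgt.
  rewrite -fine_esumK -/S lee_fin; lra.
have [N hN] : exists N, forall k, k \in X0 -> (pickle k < N)%N.
  elim: (X0) => [|k X [N IH]]; first by exists 0%N.
  exists (maxn N (pickle k).+1) => m; rewrite inE => /orP[/eqP ->|/IH h].
    by rewrite leq_max leqnn orbT.
  by rewrite leq_max h.
exists N => X uX hX.
have := @sum_le_esum (X0 ++ X); rewrite cat_uniq uX0 uX andbT /= big_cat /= -/S.
have -> : ~~ has (in_mem^~ (mem X0)) X.
  by apply/hasPn => k /hX Nk; apply/negP => /hN; rewrite ltnNge Nk.
by move=> /(_ isT); lra.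
Qed.

End FamilySums.

Section ComplexLimits.
Variable R : realType.
Implicit Types (u v : nat -> R[i]) (z w : R[i]).

Definition ccvg u z : Prop :=
  (fun p => complex.Re (u p)) @ \oo --> complex.Re z /\
  (fun p => complex.Im (u p)) @ \oo --> complex.Im z.

Lemma ccvg_cst z : ccvg (fun=> z) z.
Proof. by split; exact: cvg_cst. Qed.

Lemma ccvgD u v z w : ccvg u z -> ccvg v w -> ccvg (fun p => u p + v p) (z + w).
Proof.
move=> [u1 u2] [v1 v2]; split.
  by rewrite raddfD; under eq_fun do rewrite raddfD; exact: cvgD.
by rewrite raddfD; under eq_fun do rewrite raddfD; exact: cvgD.
Qed.

Lemma ccvgM u z w : ccvg u z -> ccvg (fun p => w * u p) (w * z).
Proof.
case: w => a b [u1 u2]; split.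
  rewrite (_ : (fun p => _) = fun p => a * complex.Re (u p) - b * complex.Im (u p)).
    by case: z u1 u2 => x y u1 u2; apply: cvgB; apply: cvgMr.
  by apply/funext => p; case: (u p).
rewrite (_ : (fun p => _) = fun p => a * complex.Im (u p) + b * complex.Re (u p)).
  by case: z u1 u2 => x y u1 u2; apply: cvgD; apply: cvgMr.
by apply/funext => p; case: (u p).
Qed.

Lemma ccvg_sum (J : Type) (r : seq J) (u : J -> nat -> R[i]) (z : J -> R[i]) :
  (forall j, ccvg (u j) (z j)) ->
  ccvg (fun p => \sum_(j <- r) u j p) (\sum_(j <- r) z j).
Proof.
move=> h; elim: r => [|j r IH].
  by rewrite big_nil; under eq_fun do rewrite big_nil; exact: ccvg_cst.
by rewrite big_cons; under eq_fun do rewrite big_cons; exact: ccvgD.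
Qed.

Lemma ccvg_unique u z w : ccvg u z -> ccvg u w -> z = w.
Proof.
case: z => a b; case: w => c d [u1 u2] [v1 v2]; congr (_ +i* _)%C.
  exact: cvg_unique u1 v1.
exact: cvg_unique u2 v2.
Qed.

Lemma ccvg_dist u z :
  (forall e : R, 0 < e -> exists N, forall p, (N <= p)%N -> cmod (u p - z) <= e) ->
  ccvg u z.
Proof.
move=> h; split; apply/cvgrPdist_le => e /h[N hN]; exists N => // p /= Np.
  rewrite -normrN opprB -raddfB; exact: le_trans (Re_le_cmod _) (hN p Np).
rewrite -normrN opprB -raddfB; exact: le_trans (Im_le_cmod _) (hN p Np).
Qed.

Lemma ccvg_cauchy u :
  (forall e : R, 0 < e -> exists N, forall p, (N <= p)%N -> cmod (u p - u N) <= e) ->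
  exists z, ccvg u z.
Proof.
move=> h.
have H (v : nat -> R) : (forall p q, `|v p - v q| <= cmod (u p - u q)) ->
    exists l : R, v @ \oo --> l.
  move=> hv; suff /cvg_ex[l hl] : cvg (v @ \oo) by exists l.
  apply/cauchy_cvgP/cauchy_exP => e e0; have [N hN] := h (e / 2) ltac:(lra).
  exists (v N); exists N => // p /= Np; rewrite /ball /=.
  rewrite distrC; apply: le_lt_trans (hv p N) _; apply: le_lt_trans (hN p Np) _; lra.
have [|a ha] := H (fun p => complex.Re (u p)).
  by move=> p q; rewrite -raddfB; exact: Re_le_cmod.
have [|b hb] := H (fun p => complex.Im (u p)).
  by move=> p q; rewrite -raddfB; exact: Im_le_cmod.
by exists (a +i* b)%C.
Qed.

Lemma ccvg_cmod_sqr u z : ccvg u z ->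
  (fun p => cmod (u p) ^+ 2) @ \oo --> cmod z ^+ 2.
Proof.
move=> [u1 u2]; rewrite cmod_sqr; under eq_fun do rewrite cmod_sqr.
by apply: cvgD; rewrite expr2; apply: cvgM.
Qed.

Lemma cvg_sum_seq (J : Type) (r : seq J) (u : J -> nat -> R) (l : J -> R) :
  (forall j, u j @ \oo --> l j) ->
  (fun p => \sum_(j <- r) u j p) @ \oo --> \sum_(j <- r) l j.
Proof.
move=> h; elim: r => [|j r IH].
  by rewrite big_nil; under eq_fun do rewrite big_nil; exact: cvg_cst.
by rewrite big_cons; under eq_fun do rewrite big_cons; exact: cvgD.
Qed.

Lemma cvg_le_bound (u : nat -> R) (l c : R) :
  u @ \oo --> l -> (forall p, u p <= c) -> l <= c.
Proof.
move=> ul uc; have e : lim (u @ \oo) = l by apply: cvg_lim ul.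
by rewrite -e; apply: limr_le; [apply: (cvgP l ul)|exact: nearW].
Qed.

End ComplexLimits.

(** * Spinor fields *)

Section SpinorExtension.
Variables (R : realType) (n : nat).
Implicit Types (f : spinor_field R n) (X Y : seq 'rV[int]_n) (k m : 'rV[int]_n).

Lemma spinor_norm_sqr (v : spinor R n) :
  spinor_norm v ^+ 2 = \sum_i cmod (v i 0) ^+ 2.
Proof. by rewrite sqr_sqrtr // sumr_ge0 // => i _; exact: sqr_ge0. Qed.

Lemma cmod_coord_le (v : spinor R n) i : cmod (v i 0) ^+ 2 <= spinor_norm v ^+ 2.
Proof.
rewrite spinor_norm_sqr (bigD1 i) //= lerDl sumr_ge0 // => j _; exact: sqr_ge0.
Qed.

Variable K : 'rV[int]_n -> 'rV[int]_n -> 'M[R[i]]_(2 ^ n./2).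

Definition kernel_sum Y f : spinor_field R n := fun k => \sum_(m <- Y) K k m *m f m.

Lemma kernel_sum_linear Y (z : R[i]) f g k :
  kernel_sum Y (z *: f + g) k = z *: kernel_sum Y f k + kernel_sum Y g k.
Proof.
rewrite /kernel_sum scaler_sumr -big_split; apply: eq_bigr => m _ /=.
by rewrite mulmxDr scalemxAr.
Qed.

Variables (w1 w2 : 'rV[int]_n -> R) (M : R).
Hypotheses (w1_gt0 : forall k, 0 < w1 k) (w2_ge0 : forall k, 0 <= w2 k) (M_ge0 : 0 <= M).
Hypothesis hK : forall X Y f, uniq X -> uniq Y ->
  \sum_(k <- X) w1 k * spinor_norm (kernel_sum Y f k) ^+ 2 <=
  M * \sum_(m <- Y) w2 m * spinor_norm (f m) ^+ 2.

Let wsq f := (\esum_(k in [set: 'rV[int]_n]) (w2 k * spinor_norm (f k) ^+ 2)%:E)%E.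

Let w2f_ge0 f k : 0 <= w2 k * spinor_norm (f k) ^+ 2.
Proof. by rewrite mulr_ge0 ?sqr_ge0. Qed.

(** The difference of two partial sums is the kernel sum over a tail of the enumeration; [hK] for
    the single frequency [k] bounds it by the corresponding tail of the norm of [f]. *)
Lemma kernel_sum_cvg f k i : (wsq f < +oo)%E ->
  exists z, ccvg (fun N => kernel_sum (enumseq _ N) f k i 0) z.
Proof.
move=> ff; apply: ccvg_cauchy => e e0.
pose e' := w1 k * e ^+ 2 / (M + 1).
have e'0 : 0 < e'.
  by rewrite divr_gt0 ?mulr_gt0 ?exprn_gt0 ?w1_gt0 // ltr_wpDl.
have [N hN] := sum_tail_small (w2f_ge0 f) ff e'0.
exists N => p /(enumseq_catP 'rV[int]_n)[Z [-> uZ hZ]].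
rewrite /kernel_sum big_cat /= [X in cmod (X - _)]mxE [X in cmod (X - _)]addrC addrK.
rewrite -/(kernel_sum Z f k).
have := hK f (isT : uniq [:: k]) uZ; rewrite big_seq1.
have hz := hN Z uZ hZ.
move=> h; rewrite -(ler_pXn2r (n := 2)) ?nnegrE ?cmod_ge0 ?(ltW e0) //.
apply: le_trans (cmod_coord_le _ _) _.
rewrite -(ler_pM2l (w1_gt0 k)); apply: le_trans h _.
apply: le_trans (ler_wpM2l M_ge0 hz) _.
rewrite /e' mulrA ler_pdivrMr; last by rewrite ltr_wpDl.
have : 0 <= w1 k * e ^+ 2 by rewrite mulr_ge0 ?sqr_ge0 // ltW.
by move: (w1 k * e ^+ 2) => x x0; rewrite mulrDr mulr1 [M * _]mulrC lerDl.
Qed.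

(** The first clause determines [T f] as a coefficientwise limit, from which linearity and the
    comparison with the commutator follow; the second is the finite estimate passed to the limit. *)
Lemma kernel_extension : exists T : spinor_field R n -> spinor_field R n,
  forall f, (wsq f < +oo)%E ->
    (forall k i, ccvg (fun N => kernel_sum (enumseq _ N) f k i 0) (T f k i 0)) /\
    forall X, uniq X -> \sum_(k <- X) w1 k * spinor_norm (T f k) ^+ 2 <= M * fine (wsq f).
Proof.
pose T f k : spinor R n :=
  (* The default 0 is taken only where the kernel sums diverge, which cannot happen for [f] of
     finite weighted norm. *)
  \col_i xget 0 [set z | ccvg (fun N => kernel_sum (enumseq _ N) f k i 0) z].
exists T => f ff.
have hT k i : ccvg (fun N => kernel_sum (enumseq _ N) f k i 0) (T f k i 0).
  rewrite /T mxE; have [z hz] := kernel_sum_cvg k i ff.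
  by case: xgetP => [y _ //|/(_ z)].
split=> // X uX.
pose u N := \sum_(k <- X) w1 k * (\sum_i cmod (kernel_sum (enumseq _ N) f k i 0) ^+ 2).
apply: (@cvg_le_bound _ u) => [|N].
  have -> : \sum_(k <- X) w1 k * spinor_norm (T f k) ^+ 2 =
      \sum_(k <- X) w1 k * (\sum_i cmod (T f k i 0) ^+ 2).
    by apply: eq_bigr => k _; rewrite spinor_norm_sqr.
  apply: cvg_sum_seq => k; apply: cvgMr; apply: cvg_sum_seq => i.
  exact: ccvg_cmod_sqr.
rewrite /u (eq_bigr (fun k => w1 k * spinor_norm (kernel_sum (enumseq _ N) f k) ^+ 2)); last first.
  by move=> k _; rewrite spinor_norm_sqr.
apply: le_trans (hK _ uX (enumseq_uniq _ _)) _.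
by apply: ler_wpM2l => //; apply: sum_le_esum => //; exact: enumseq_uniq.
Qed.

End SpinorExtension.

(** * Clifford multiplication and the symbol of the phase *)

Section Clifford.
Variables (R : realType) (n : nat) (c : 'rV[R]_n -> 'M[R[i]]_(2 ^ n./2)).
Hypothesis hc : clifford_mult c.

Lemma spinor_norm_adjoint (v : spinor R n) :
  (map_mx Num.conj v)^T *m v = ((spinor_norm v ^+ 2)%:C)%:M.
Proof.
apply/matrixP => i j; rewrite !ord1 !mxE eqxx mulr1n spinor_norm_sqr rmorph_sum.
by apply: eq_bigr => l _; rewrite !mxE mul_conj_cmod.
Qed.

(** Since [c xi] is self-adjoint with square [|xi|^2], the inner product of [c xi v] with itself is
    [|xi|^2] times that of [v]. *)
Lemma clifford_isometry xi (v : spinor R n) :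
  spinor_norm (c xi *m v) ^+ 2 = euclid_norm xi ^+ 2 * spinor_norm v ^+ 2.
Proof.
have [_ cs c2] := hc.
apply: (@complexI R); rewrite [RHS]rmorphM.
have := spinor_norm_adjoint (c xi *m v).
rewrite map_mxM trmx_mul cs mulmxA -[_ *m c xi *m c xi]mulmxA c2.
rewrite mul_mx_scalar -scalemxAl spinor_norm_adjoint scale_scalar_mx.
by move=> /matrixP /(_ 0 0); rewrite !mxE eqxx !mulr1n => <-.
Qed.

Lemma clifford0 : c 0 = 0.
Proof.
have [cl _ _] := hc; have := cl (- 1) 0 0.
by rewrite scaler0 addr0 rmorphN1 scaleN1r addNr.
Qed.

(** The symbol [c(k) / |k|], with value 0 at [k = 0]. Expanding it in coordinates reduces the
    commutator with the phase to scalar commutators with [k_l / |k|]. *)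
Definition phase_mx (k : 'rV[int]_n) : 'M[R[i]]_(2 ^ n./2) :=
  \sum_l (direction R l k)%:C *: c (delta_mx 0 l).

Lemma clifford_coord xi : c xi = \sum_l (xi 0 l)%:C *: c (delta_mx 0 l).
Proof.
have [cl _ _] := hc; rewrite {1}(row_sum_delta xi).
elim: (index_enum _) => [|l r IH]; first by rewrite !big_nil clifford0.
by rewrite !big_cons cl IH.
Qed.

Lemma dirac_phaseE f k : dirac_phase c f k = phase_mx k *m f k.
Proof.
rewrite /dirac_phase /Defs.dirac; have [->|k0] := eqVneq k 0.
  rewrite /phase_mx big1 ?mul0mx // => l _.
  by rewrite /direction mxE mul0r scale0r.
rewrite clifford_coord scalemxAl scaler_sumr; congr (_ *m _).
apply: eq_bigr => l _; rewrite scalerA -rmorphM mxE; congr (_%:C *: _).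
by rewrite mulrC.
Qed.

Lemma knorm_neq0 (k : 'rV[int]_n) : k != 0 -> knorm R k != 0.
Proof.
apply: contra => /eqP h; apply/eqP/rowP => j; rewrite mxE.
have := coord_le_knorm R k j; rewrite h normr_le0 intr_eq0 => /eqP //.
Qed.

Lemma phase_mx_le (k : 'rV[int]_n) (v : spinor R n) :
  spinor_norm (phase_mx k *m v) ^+ 2 <= spinor_norm v ^+ 2.
Proof.
rewrite -(dirac_phaseE (fun=> v) k) /dirac_phase.
have [_|k0] := eqVneq k 0.
  rewrite [leLHS]spinor_norm_sqr big1 ?sqr_ge0 // => i _.
  by rewrite mxE cmod0 expr0n.
rewrite [leLHS]spinor_norm_sqr /Defs.dirac -/(knorm R k).
under eq_bigr do rewrite mxE cmodM cmodR exprMn.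
rewrite -mulr_sumr -spinor_norm_sqr clifford_isometry -/(knorm R k).
rewrite real_normK ?num_real // exprVn mulKf // expf_neq0 //.
exact: knorm_neq0.
Qed.

End Clifford.

(** * Coefficients of left multiplication on the GNS space *)

Section L2Multiplication.
Variables (R : realType) (A : cstarAlgType R) (n : nat) (theta : 'M[R]_n).
Variables (U : 'I_n -> A) (tau : A -> R[i]).
Hypotheses (hU : nct_relations theta U) (htau : is_nct_trace U tau).
Variable lmul : A -> ('rV[int]_n -> R[i]) -> ('rV[int]_n -> R[i]).
Hypothesis hlmul : gns_left_mult U tau lmul.
Implicit Types (x y : 'rV[int]_n -> R[i]).

Lemma l2_sum_le x (X : seq 'rV[int]_n) : l2 x -> uniq X ->
  \sum_(k <- X) cmod (x k) ^+ 2 <= l2norm x ^+ 2.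
Proof.
move=> hx uX; rewrite /l2norm sqr_sqrtr; last first.
  by apply: fine_ge0; apply: esum_ge0 => k _; rewrite lee_fin sqr_ge0.
by apply: sum_le_esum => // k; exact: sqr_ge0.
Qed.

Lemma l2_of_bound x (b : R) :
  (forall X, uniq X -> \sum_(k <- X) cmod (x k) ^+ 2 <= b) ->
  l2 x /\ l2norm x <= Num.sqrt b.
Proof.
move=> h; have hb : (l2sq x <= b%:E)%E by apply: esum_le_bound.
have hx : l2 x by apply: le_lt_trans hb (ltry _).
split=> //; apply: ler_wsqrtr; rewrite -lee_fin fine_esumK //.
by move=> k; exact: sqr_ge0.
Qed.

Lemma l2_lin (z : R[i]) x y : l2 x -> l2 y -> l2 (z *: x + y).
Proof.
move=> hx hy.
apply: (l2_of_bound (b := 2 * (cmod z ^+ 2 * l2norm x ^+ 2 + l2norm y ^+ 2)) _).1.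
move=> X uX; apply: (@le_trans _ _ (\sum_(k <- X) 2 * (cmod z ^+ 2 * cmod (x k) ^+ 2 + cmod (y k) ^+ 2))).
  by apply: ler_sum => k _; rewrite -exprMn -cmodM; exact: sqr_cmodD.
rewrite -mulr_sumr ler_wpM2l // big_split /= -mulr_sumr.
by apply: lerD; rewrite ?ler_wpM2l ?sqr_ge0 ?l2_sum_le.
Qed.

Let single (m : 'rV[int]_n) := gns_vec U tau (umono U m).

Lemma singleE m k : single m k = (k == m)%:R.
Proof. exact: (trace_orthonormal hU htau). Qed.

Lemma l2_single m : l2 (single m).
Proof.
apply: (l2_of_bound (b := 1) _).1 => X uX.
have e k : k != m -> cmod (single m k) ^+ 2 = 0.
  by move=> km; rewrite singleE (negbTE km) cmod0 expr0n.
have [mX|mX] := boolP (m \in X).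
  rewrite (bigD1_seq m) //= big1 ?addr0 => [|k km]; last exact: e.
  by rewrite singleE eqxx cmod1 expr1n.
by rewrite big_seq big1 // => k kX; apply: e; apply: contraNneq mX => <-.
Qed.

Lemma l2_0 : l2 (0 : 'rV[int]_n -> R[i]).
Proof.
apply: (l2_of_bound (b := 0) _).1 => X uX.
by rewrite big1 // => k _; rewrite cmod0 expr0n.
Qed.

(** [lmul] is known only on the images of algebra elements and through its boundedness. Finite
    combinations of basis vectors are such images termwise, and boundedness controls the remainder
    of the truncated series. *)
Lemma lmul_ccvg a x k : l2 x ->
  ccvg (fun N => \sum_(m <- enumseq _ N) mcoef U tau a k m * x m) (lmul a x k).
Proof.
move=> hx; have [[llin lmem [M hM]] lgns] := hlmul a.
pose trunc (Y : seq 'rV[int]_n) := \sum_(m <- Y) x m *: single m.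
have l2t Y : l2 (trunc Y).
  elim: Y => [|m Y IH]; first by rewrite /trunc big_nil; exact: l2_0.
  by rewrite /trunc big_cons; apply: l2_lin => //; exact: l2_single.
have l0 : lmul a 0 = 0.
  by have := llin (- 1) 0 0 l2_0 l2_0; rewrite scaler0 addr0 scaleN1r addNr.
have lt Y : lmul a (trunc Y) k = \sum_(m <- Y) mcoef U tau a k m * x m.
  elim: Y => [|m Y IH]; first by rewrite /trunc !big_nil l0.
  have -> : trunc (m :: Y) = x m *: single m + trunc Y by rewrite /trunc big_cons.
  rewrite (llin _ _ _ (l2_single m) (l2t Y)) big_cons -IH.
  rewrite [LHS]/(x m * lmul a (single m) k + lmul a (trunc Y) k) /single lgns.
  by rewrite /gns_vec /mcoef mulrA mulrC.
have tE Y m : uniq Y -> trunc Y m = if m \in Y then x m else 0.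
  move=> uY; rewrite /trunc fct_sumE.
  have sE m' : (x m' *: single m') m = x m' * (m == m')%:R by rewrite -singleE.
  have e m' : m' != m -> (x m' *: single m') m = 0.
    by move=> km; rewrite sE eq_sym (negbTE km) mulr0.
  case: ifP => mY.
    rewrite (bigD1_seq m) //= big1 ?addr0 => [|m' km]; last exact: e.
    by rewrite sE eqxx mulr1.
  by rewrite big_seq big1 // => m' kX; apply: e; apply: contraFneq mY => <-.
apply: ccvg_dist => e e0.
pose e' := e / (`|M| + 1).
have M1 : 0 < `|M| + 1 by rewrite ltr_wpDl.
have e'0 : 0 < e' by rewrite divr_gt0.
have [N hN] := sum_tail_small (fun k => sqr_ge0 (cmod (x k))) hx (exprn_gt0 2 e'0).
exists N => p Np.
set Y := enumseq _ p; have uY : uniq Y by exact: enumseq_uniq.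
(* The remainder [x - trunc Y], written in the form to which the linearity clause of [bounded_op]
   applies. *)
pose r := (- 1) *: trunc Y + x.
have [l2r nr] : l2 r /\ l2norm r <= Num.sqrt (e' ^+ 2).
  apply: l2_of_bound => X uX.
  apply: le_trans (hN [seq m <- X | m \notin Y] (filter_uniq _ uX) _); last first.
    move=> m; rewrite mem_filter => /andP[mY _]; rewrite leqNgt; apply: contra mY => mN.
    by apply: mem_enumseq; exact: leq_trans mN Np.
  rewrite big_filter [leRHS]big_mkcond; apply: ler_sum => m _.
  have -> : r m = - trunc Y m + x m by rewrite /r scaleN1r.
  by rewrite tE //; case: ifP => _ /=; rewrite ?addNr ?cmod0 ?expr0n // oppr0 add0r.
have -> : \sum_(m <- Y) mcoef U tau a k m * x m - lmul a x k = - lmul a r k.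
  have -> : lmul a r k = - lmul a (trunc Y) k + lmul a x k by rewrite /r llin // scaleN1r.
  by rewrite -lt opprD opprK.
rewrite cmodN; apply: (@le_trans _ _ (l2norm (lmul a r))).
  rewrite -(ler_pXn2r (n := 2)) ?nnegrE ?cmod_ge0 ?sqrtr_ge0 //.
  by have := l2_sum_le (X := [:: k]) (lmem r l2r) isT; rewrite big_seq1.
apply: le_trans (hM r l2r) _.
move: nr; rewrite sqrtr_sqr (gtr0_norm e'0) /e' ler_pdivlMr // => nr.
have := sqrtr_ge0 (fine (l2sq r)); rewrite -/(l2norm r) => n0.
have := ler_norm M; nra.
Qed.

End L2Multiplication.

(** * The commutator with the phase *)

Section PhaseKernel.
Variables (R : realType) (n : nat) (c : 'rV[R]_n -> 'M[R[i]]_(2 ^ n./2)).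
Hypothesis hc : clifford_mult c.
Variable B : 'rV[int]_n -> 'rV[int]_n -> R[i].
Implicit Types (f : spinor_field R n) (X Y : seq 'rV[int]_n) (k m : 'rV[int]_n).

Definition phase_kernel k m : 'M[R[i]]_(2 ^ n./2) :=
  B k m *: (phase_mx c k - phase_mx c m).

Let Bl l k m := (direction R l k - direction R l m)%:C * B k m.

Let e_ (l : 'I_n) := c (delta_mx 0 l).

Lemma phase_kernel_coord f Y k i :
  (kernel_sum phase_kernel Y f k) i 0 =
  \sum_l \sum_(m <- Y) Bl l k m * (e_ l *m f m) i 0.
Proof.
rewrite /kernel_sum summxE exchange_big /=; apply: eq_bigr => m _.
rewrite /phase_kernel /phase_mx -sumrB -scalemxAl mulmx_suml mxE summxE mulr_sumr.
apply: eq_bigr => l _; rewrite -scalerBl -scalemxAl mxE /Bl rmorphB /e_; ring.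
Qed.

Lemma unit_vector_norm (l : 'I_n) : euclid_norm (delta_mx 0 l : 'rV[R]_n) ^+ 2 = 1.
Proof.
rewrite sqr_sqrtr; last by rewrite sumr_ge0 // => j _; exact: sqr_ge0.
rewrite (bigD1 l) //= big1 ?addr0 => [|j jl]; first by rewrite mxE !eqxx expr1n.
by rewrite mxE (negbTE jl) andbF expr0n.
Qed.

Variables (w1' w1 w2 : 'rV[int]_n -> R) (C : 'I_n -> R).
Hypotheses (w2_ge0 : forall k, 0 <= w2 k) (w1_gt0 : forall k, 0 < w1 k) (w1'E : forall k, w1' k * w1 k = 1).
Hypothesis C_ge0 : forall l, 0 <= C l.
Hypothesis hB : forall l X Y g h, uniq X -> uniq Y ->
  2 * cmod (bform X Y (Bl l) g h) <=
  C l * (\sum_(k <- X) w1' k * cmod (g k) ^+ 2 + \sum_(m <- Y) w2 m * cmod (h m) ^+ 2).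

(** Expanding over coordinates [l] and spinor components [i] gives scalar forms applied to the
    components of [c(e_l) f]. As [c(e_l)] is isometric, summing over [i] restores [|f m|^2]. *)
Lemma phase_kernel_form X Y (g : 'rV[int]_n -> 'I_(2 ^ n./2) -> R[i]) f :
  uniq X -> uniq Y ->
  2 * cmod (\sum_(k <- X) \sum_i g k i * (kernel_sum phase_kernel Y f k) i 0) <=
  (\sum_l C l) * (\sum_(k <- X) w1' k * (\sum_i cmod (g k i) ^+ 2) +
                  \sum_(m <- Y) w2 m * spinor_norm (f m) ^+ 2).
Proof.
move=> uX uY.
have -> : \sum_(k <- X) \sum_i g k i * (kernel_sum phase_kernel Y f k) i 0 =
    \sum_l \sum_i bform X Y (Bl l) (g^~ i) (fun m => (e_ l *m f m) i 0).
  rewrite [LHS]exchange_big [RHS]exchange_big /=; apply: eq_bigr => i _.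
  rewrite /bform [RHS]exchange_big /=; apply: eq_bigr => k _.
  rewrite phase_kernel_coord mulr_sumr; apply: eq_bigr => l _.
  by rewrite mulr_sumr; apply: eq_bigr => m _; rewrite mulrA.
rewrite mulr_suml; apply: (@le_trans _ _ (\sum_l 2 * cmod (\sum_i bform X Y (Bl l) (g^~ i)
   (fun m => (e_ l *m f m) i 0)))).
  by rewrite -mulr_sumr ler_wpM2l // cmod_sum.
apply: ler_sum => l _.
apply: (@le_trans _ _ (\sum_i 2 * cmod (bform X Y (Bl l) (g^~ i)
   (fun m => (e_ l *m f m) i 0)))).
  by rewrite -mulr_sumr ler_wpM2l // cmod_sum.
apply: le_trans (ler_sum _ (fun i _ => hB l (g^~ i) _ uX uY)) _.
rewrite -mulr_sumr ler_wpM2l // big_split /= exchange_big /= lerD //.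
  by apply: ler_sum => k _; rewrite mulr_sumr.
rewrite exchange_big /=; apply: ler_sum => m _; rewrite -mulr_sumr.
by rewrite -spinor_norm_sqr clifford_isometry // unit_vector_norm mul1r.
Qed.

(** Duality: the form is tested on the conjugate of the output, weighted by [w1] and scaled by
    [1 / D]. With [Z] the left side and [Q] the sum on the right, this reads
    [2 Z / D <= Z / D + D Q], so [Z <= D^2 Q]. The added 1 ensures [D > 0]. *)
Lemma phase_kernel_bound X Y f : uniq X -> uniq Y ->
  \sum_(k <- X) w1 k * spinor_norm (kernel_sum phase_kernel Y f k) ^+ 2 <=
  (\sum_l C l + 1) ^+ 2 * \sum_(m <- Y) w2 m * spinor_norm (f m) ^+ 2.
Proof.
move=> uX uY; set D := \sum_l C l + 1.
have S0 : 0 <= \sum_l C l by rewrite sumr_ge0.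
have D0 : 0 < D by rewrite /D ltr_wpDl.
set Q := \sum_(m <- Y) _; set Z := \sum_(k <- X) _.
pose S k := kernel_sum phase_kernel Y f k.
pose g k i : R[i] := (w1 k / D)%:C * Num.conj (S k i 0).
have := phase_kernel_form g f uX uY; rewrite -/Q.
have -> : \sum_(k <- X) \sum_i g k i * (kernel_sum phase_kernel Y f k) i 0 = (Z / D)%:C.
  rewrite /Z mulr_suml rmorph_sum; apply: eq_bigr => k _ /=.
  rewrite spinor_norm_sqr mulrAC mulr_sumr rmorph_sum; apply: eq_bigr => i _ /=.
  by rewrite /g -mulrA mul_conj_cmod -rmorphM.
have -> : \sum_(k <- X) w1' k * (\sum_i cmod (g k i) ^+ 2) = Z / D ^+ 2.
  rewrite /Z mulr_suml; apply: eq_bigr => k _.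
  rewrite spinor_norm_sqr -/(S k) mulrAC !mulr_sumr; apply: eq_bigr => i _.
  rewrite /g cmodM cmodR cmodJ ger0_norm ?divr_ge0 ?(ltW (w1_gt0 k)) ?(ltW D0) //.
  transitivity ((w1' k * w1 k) * (w1 k / D ^+ 2 * cmod (S k i 0) ^+ 2)); last first.
    by rewrite w1'E mul1r.
  by field; rewrite gt_eqF.
have Z0 : 0 <= Z by rewrite sumr_ge0 // => k _; rewrite mulr_ge0 ?sqr_ge0 // ltW.
rewrite cmodR ger0_norm ?divr_ge0 ?(ltW D0) // => h.
have Q0 : 0 <= Q by rewrite sumr_ge0 // => m _; rewrite mulr_ge0 ?sqr_ge0.
have {}h : 2 * (Z / D) <= D * (Z / D ^+ 2 + Q).
  apply: le_trans h _; rewrite ler_wpM2r ?addr_ge0 ?divr_ge0 ?sqr_ge0 //.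
  by rewrite /D lerDl.
have {}h : 2 * (Z / D) <= Z / D + D * Q.
  apply: le_trans h _; rewrite mulrDr lerD2r le_eqVlt; apply/orP; left; apply/eqP.
  by field; rewrite gt_eqF.
have {}h : Z / D <= D * Q by lra.
by move: h; rewrite ler_pdivrMr // expr2 [D * D * Q]mulrAC.
Qed.

End PhaseKernel.

Section CommutatorOnL2.
Variables (R : realType) (A : cstarAlgType R) (n : nat) (theta : 'M[R]_n).
Variables (U : 'I_n -> A) (tau : A -> R[i]).
Hypotheses (hU : nct_relations theta U) (htau : is_nct_trace U tau).
Variable lmul : A -> ('rV[int]_n -> R[i]) -> ('rV[int]_n -> R[i]).
Hypothesis hlmul : gns_left_mult U tau lmul.
Variable c : 'rV[R]_n -> 'M[R[i]]_(2 ^ n./2).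
Hypothesis hc : clifford_mult c.

Lemma l2_component (f : spinor_field R n) i : L2_spinor f -> l2 (fun m => f m i 0).
Proof.
move=> hf; apply: le_lt_trans hf; apply: le_esum => k _.
by rewrite lee_fin; exact: cmod_coord_le.
Qed.

Lemma L2_dirac_phase (f : spinor_field R n) : L2_spinor f -> L2_spinor (dirac_phase c f).
Proof.
move=> hf; apply: le_lt_trans hf; apply: le_esum => k _.
by rewrite lee_fin dirac_phaseE //; exact: phase_mx_le.
Qed.

(** On square-integrable fields the commutator has as coefficients the limits of the very kernel
    sums that define its extension. *)
Lemma phase_commutator_ccvg a (f : spinor_field R n) k i : L2_spinor f ->
  ccvg (fun N => kernel_sum (phase_kernel c (mcoef U tau a)) (enumseq _ N) f k i 0)
    (phase_commutator c lmul a f k i 0).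
Proof.
move=> hf; have hpf := L2_dirac_phase hf.
have -> : phase_commutator c lmul a f k i 0 =
    \sum_j phase_mx c k i j * lmul a (fun m => f m j 0) k +
    (- 1) * lmul a (fun m => (dirac_phase c f) m i 0) k.
  rewrite /phase_commutator.
  have -> : (dirac_phase c (spinor_mult lmul a f) - spinor_mult lmul a (dirac_phase c f)) k
    = dirac_phase c (spinor_mult lmul a f) k - spinor_mult lmul a (dirac_phase c f) k by [].
  rewrite dirac_phaseE // !mxE mulN1r; congr (_ - _).
  by apply: eq_bigr => j _; rewrite mxE.
rewrite (_ : (fun N => _) = (fun N =>
    \sum_j phase_mx c k i j * (\sum_(m <- enumseq _ N) mcoef U tau a k m * f m j 0) +
    (- 1) * (\sum_(m <- enumseq _ N) mcoef U tau a k m * (dirac_phase c f) m i 0))); last first.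
  apply/funext => N; rewrite /kernel_sum summxE.
  under [X in _ = X + _]eq_bigr do rewrite mulr_sumr.
  rewrite exchange_big /= mulr_sumr -big_split /=; apply: eq_bigr => m _.
  rewrite /phase_kernel -scalemxAl mulmxBl !mxE dirac_phaseE // mulrBr mulN1r !mxE.
  by congr (_ - _); rewrite mulr_sumr; apply: eq_bigr => j _; rewrite mulrCA.
apply: ccvgD; last first.
  by apply: ccvgM; apply: (lmul_ccvg hU htau hlmul); exact: (l2_component i hpf).
apply: ccvg_sum => j; apply: ccvgM; apply: (lmul_ccvg hU htau hlmul).
exact: (l2_component j hf).
Qed.

End CommutatorOnL2.

Lemma L2_sobolev (R : realType) (n : nat) (s : R) (f : spinor_field R n) :
  s <= 0 -> L2_spinor f -> sobolev s f.
Proof.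
move=> s0 hf; apply: le_lt_trans hf; apply: le_esum => k _.
rewrite lee_fin ler_piMl ?sqr_ge0 //.
rewrite -[leRHS](powRr0 (1 + euclid_norm (freq R k) ^+ 2)); apply: ler_powR => //.
by rewrite lerDl sqr_ge0.
Qed.

Lemma sobolev_lin (R : realType) (n : nat) (s : R) (z : R[i]) (f g : spinor_field R n) :
  sobolev s f -> sobolev s g -> sobolev s (z *: f + g).
Proof.
move=> hf hg.
have w0 (h : spinor_field R n) k : 0 <= sweight s k * spinor_norm (h k) ^+ 2.
  by rewrite mulr_ge0 ?sweight_ge0 ?sqr_ge0.
pose F := fine (sobolevsq s f); pose G := fine (sobolevsq s g).
apply: (@le_lt_trans _ _ (2 * (cmod z ^+ 2 * F + G))%:E); last exact: ltry.
apply: esum_le_bound => X uX.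
apply: (@le_trans _ _ (\sum_(k <- X) 2 * (cmod z ^+ 2 * (sweight s k * spinor_norm (f k) ^+ 2)
   + sweight s k * spinor_norm (g k) ^+ 2))).
  apply: ler_sum => k _; rewrite -/(sweight s k).
  have -> : 2 * (cmod z ^+ 2 * (sweight s k * spinor_norm (f k) ^+ 2)
   + sweight s k * spinor_norm (g k) ^+ 2) =
    sweight s k * (2 * (cmod z ^+ 2 * spinor_norm (f k) ^+ 2 + spinor_norm (g k) ^+ 2)).
    by ring.
  rewrite ler_wpM2l ?sweight_ge0 // !spinor_norm_sqr mulr_sumr -big_split mulr_sumr.
  apply: ler_sum => i _; have -> : (z *: f + g) k = z *: f k + g k by [].
  by rewrite !mxE -exprMn -cmodM; exact: sqr_cmodD.
rewrite -mulr_sumr ler_wpM2l // big_split /= -mulr_sumr.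
apply: lerD; first by rewrite ler_wpM2l ?sqr_ge0 //; exact: (sum_le_esum (w0 f) hf).
exact: (sum_le_esum (w0 g) hg).
Qed.

Theorem theorem4p11 (R : realType) (n : nat) (theta : 'M[R]_n)
  (htheta : theta^T = - theta)
  (A : cstarAlgType R) (U : 'I_n -> A) (hA : is_nctorus theta U)
  (act : 'rV[R[i]]_n -> A -> A) (hact : torus_action U act)
  (tau : A -> R[i]) (htau : is_nct_trace U tau)
  (lmul : A -> ('rV[int]_n -> R[i]) -> ('rV[int]_n -> R[i]))
  (hlmul : gns_left_mult U tau lmul)
  (c : 'rV[R]_n -> 'M[R[i]]_(2 ^ n./2)) (hc : clifford_mult c)
  (alpha : R) (halpha : 0 < alpha < 1)
  (a : A) (ha : holder act alpha a)
  (s : R) (hs : - alpha < s < 0) :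
  exists T : spinor_field R n -> spinor_field R n,
    bounded_op (@sobolev R n s) (sobolev_norm s)
               (@sobolev R n (s + alpha)) (sobolev_norm (s + alpha)) T /\
    forall f, L2_spinor f -> T f = phase_commutator c lmul a f.
Proof.
case: hA => hU hgen _; have [alpha0 alpha1] := andP halpha; have [s1 s0] := andP hs.
have [C1 C10 hC1] := holder_kbound hU hgen htau hact alpha0 ha.
pose B := mcoef U tau a.
have C00 : 0 <= 2 * cnorm a by rewrite mulr_ge0 ?cnorm_ge0.
have [C C_ge0 hC] := direction_commutator halpha C00 C10
  (fun X Y uX uY => mcoef_kbound hU htau a uX uY) hC1.
have /choice[Cf hCf] : forall l : 'I_n, exists C' : R, 0 <= C' /\
    forall X Y g h, uniq X -> uniq Y ->
    2 * cmod (bform X Y (fun k m => (direction R l k - direction R l m)%:C * B k m) g h) <=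
    C' * (\sum_(k <- X) sweight (- (s + alpha)) k * cmod (g k) ^+ 2 +
          \sum_(m <- Y) sweight s m * cmod (h m) ^+ 2).
  by move=> l; have [C' C'0 hC'] := weighted_schur C_ge0 hs (hC l); exists C'.
have wgt0 (v : R) (k : 'rV[int]_n) : 0 < sweight v k.
  by apply: powR_gt0; case/andP: (shell_base R k).
(* The weights of exponents [s + alpha] and [- (s + alpha)] are dual, as [phase_kernel_bound]
   requires. *)
have winv (k : 'rV[int]_n) : sweight (- (s + alpha)) k * sweight (s + alpha) k = 1.
  by rewrite /sweight powRN mulVf // gt_eqF // wgt0.
pose M := (\sum_l Cf l + 1) ^+ 2.
have M0 : 0 <= M by exact: sqr_ge0.
have bound X Y f : uniq X -> uniq Y ->
    \sum_(k <- X) sweight (s + alpha) k * spinor_norm (kernel_sum (phase_kernel c B) Y f k) ^+ 2 <=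
    M * \sum_(m <- Y) sweight s m * spinor_norm (f m) ^+ 2.
  move=> uX uY; apply: (phase_kernel_bound hc (w1' := sweight (- (s + alpha)))) => //.
  - by move=> k; exact: ltW.
  - by move=> l; case: (hCf l).
  - by move=> l; case: (hCf l) => _; apply.
have [T hT] := kernel_extension (wgt0 (s + alpha)) (fun k => ltW (wgt0 s k)) M0 bound.
have conv f k i (hf : sobolev s f) := (hT f hf).1 k i.
exists T; split; last first.
  (* As [s < 0], [f] also lies in [W^s], so both sides are limits of the same kernel sums. *)
  move=> f hf; apply/funext => k; apply/matrixP => i j; rewrite ord1.
  apply: ccvg_unique (conv f k i (L2_sobolev (ltW s0) hf)) _.
  exact: (phase_commutator_ccvg hU htau hlmul hc a k i hf).
have Tbound f : sobolev s f ->
    (sobolevsq (s + alpha) (T f) <= (M * fine (sobolevsq s f))%:E)%E.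
  by move=> hf; apply: esum_le_bound; exact: (hT f hf).2.
split.
- move=> z f g hf hg; apply/funext => k; apply/matrixP => i j; rewrite ord1.
  apply: ccvg_unique (conv _ k i (sobolev_lin z hf hg)) _.
  rewrite (_ : (fun N => _) = (fun N => z * kernel_sum (phase_kernel c B) (enumseq _ N) f k i 0
     + kernel_sum (phase_kernel c B) (enumseq _ N) g k i 0)); last first.
    by apply/funext => N; rewrite kernel_sum_linear !mxE.
  have -> : (z *: T f + T g) k i 0 = z * T f k i 0 + T g k i 0.
    by have -> : (z *: T f + T g) k = z *: T f k + T g k by []; rewrite !mxE.
  by apply: ccvgD; [apply: ccvgM|]; exact: conv.
- by move=> f hf; apply: le_lt_trans (Tbound f hf) (ltry _).
exists (\sum_l Cf l + 1) => f hf.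
have S0 : 0 <= \sum_l Cf l + 1.
  by rewrite addr_ge0 // sumr_ge0 // => l _; case: (hCf l).
rewrite /sobolev_norm -{1}(ger0_norm S0) -sqrtr_sqr -sqrtrM ?sqr_ge0 //.
apply: ler_wsqrtr; rewrite -lee_fin; apply: le_trans (Tbound f hf).
rewrite fineK // ge0_fin_numE; first exact: le_lt_trans (Tbound f hf) (ltry _).
apply: esum_ge0 => k _; rewrite lee_fin mulr_ge0 ?sqr_ge0 //.
exact: ltW (wgt0 _ k).
Qed.
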